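(* Let $P$ be an infinite field, let $\Theta=\mathrm{Com}\text{-}P$ be the variety of all commutative and associative algebras with unit over $P$, and let $H_1$ and $H_2$ be nonzero algebras in $\Theta$. Then the following three conditions are equivalent: 1. The categories of algebraic sets $K_\Theta(H_1)$ and $K_\Theta(H_2)$ are correctly isomorphic. 2. The categories of algebraic sets $K_\Theta(H_1)$ and $K_\Theta(H_2)$ are correctly equivalent. 3. The algebras $H_1$ and $H_2$ are twisted geometrically equivalent.
   Context: Let $\Theta$ be a variety of algebras. Fix an infinite set $X^0$. $\Theta^0$ is the category whose objects are the free algebras $W=W(X)$ of $\Theta$ with $X$ a finite subset of $X^0$, and whose morphisms are all homomorphisms. Fix $H\in\Theta$. Galois correspondence. For a set $T\subset W\times W$ put $T'_H=\{\mu\in \mathrm{Hom}(W,H): T\subset \mathrm{Ker}\,\mu\}$, where $\mathrm{Ker}\,\mu=\{(w,w'):w^\mu=w'^\mu\}$; for $A\subset \mathrm{Hom}(W,H)$ put $A'=A'_W=\bigcap_{\mu\in A}\mathrm{Ker}\,\mu$ (equal to $W\times W$ if $A=\emptyset$). Put $T''_H=(T'_H)'$. A set $A$ of the form $T'_H$ is called an algebraic set; a congruence of the form $A'$ is called $H$-closed. Categories. $K^0_\Theta(H)$: objects are the sets $\mathrm{Hom}(W(X),H)$, $W(X)\in \mathrm{Ob}\,\Theta^0$; morphisms $\tilde s:\mathrm{Hom}(W(X),H)\to \mathrm{Hom}(W(Y),H)$ are given by homomorphisms $s:W(Y)\to W(X)$ via $\tilde s(\nu)=\nu s$. $K_\Theta(H)$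 (algebraic sets over $H$): objects are pairs $(X,A)$ with $A$ an algebraic set in $\mathrm{Hom}(W(X),H)$; morphisms $[s]:(X,A)\to(Y,B)$ are the maps $A\to B$, $\nu\mapsto \nu s$, given by those homomorphisms $s:W(Y)\to W(X)$ with $\nu s\in B$ for all $\nu\in A$. $K^0_\Theta(H)$ is a subcategory of $K_\Theta(H)$. $C_\Theta(H)$: objects are $W/T$ with $W\in \mathrm{Ob}\,\Theta^0$ and $T$ an $H$-closed congruence of $W$; morphisms are homomorphisms. When the variety $\mathrm{Var}(H)$ generated by $H$ is $\Theta$ (which is the case here), $(X,A)\mapsto W(X)/A'$ and $W(X)/T\mapsto (X,T'_H)$ determine a duality between $K_\Theta(H)$ and $C_\Theta(H)$, and $\Theta^0$ is a subcategory of $C_\Theta(H)$. Hence every functor $F:K_\Theta(H_1)\to K_\Theta(H_2)$ has a corresponding functor $\Phi:C_\Theta(H_1)\to C_\Theta(H_2)$. Correct isomorphism. An isomorphism $F:K_\Theta(H_1)\to K_\Theta(H_2)$, with corresponding isomorphism $\Phi:C_\Theta(H_1)\to C_\Theta(H_2)$, is correct if (1) $\Phi$ induces an automorphism $\varphi:\Theta^0\to\Theta^0$ and $F$ induces an isomorphism $K^0_\Theta(H_1)\to K^0_\Theta(H_2)$; (2) if $(X,A_1),(X,A_2)$ are objects of $K_\Theta(H_1)$ with $A_1\subset A_2$ and $F(X,A_1)=(Y_1,B_1)$, $F(X,A_2)=(Y_2,B_2)$, then $Y_1=Y_2$ and $B_1\subset B_2$. Correct equivalence (defined in the same spirit). An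 equivalence given by functors $F_1:K_\Theta(H_1)\to K_\Theta(H_2)$, $F_2:K_\Theta(H_2)\to K_\Theta(H_1)$, with corresponding functors $\Phi_1,\Phi_2$ between $C_\Theta(H_1)$ and $C_\Theta(H_2)$, is correct if (1) $\Phi_1,\Phi_2$ induce functors $\varphi,\psi:\Theta^0\to\Theta^0$ forming an autoequivalence of $\Theta^0$ (that is, $\psi\varphi$ and $\varphi\psi$ are isomorphic to the identity functor), and $F_1,F_2$ induce an equivalence between $K^0_\Theta(H_1)$ and $K^0_\Theta(H_2)$; (2) both $F_1$ and $F_2$ satisfy condition (2) in the definition of a correct isomorphism. Two categories are correctly isomorphic (correctly equivalent) if a correct isomorphism (correct equivalence) between them exists. Geometrical equivalence. $H_1,H_2\in\Theta$ are geometrically equivalent if $T''_{H_1}=T''_{H_2}$ for every $W\in \mathrm{Ob}\,\Theta^0$ and every $T\subset W\times W$. For $\sigma\in \mathrm{Aut}(P)$ and a $P$-algebra $H$, the algebra $H^\sigma$ is $H$ with the same operations except that multiplication by scalars is replaced by $\lambda\circ a=\lambda^{\sigma^{-1}}\cdot a$, $\lambda\in P$, $a\in H$. $H_1$ and $H_2$ are twisted geometrically equivalent if $H_1^\sigma$ and $H_2$ are geometrically equivalent for some $\sigma\in \mathrm{Aut}(P)$. *)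

(* Defs.v *)
From HB Require Import structures.
From mathcomp Require Import all_boot all_order all_algebra finmap.
From mathcomp Require Import boolp classical_sets functions cardinality.
From mathcomp Require Import mpoly.

Set Implicit Arguments.
Unset Strict Implicit.
Unset Printing Implicit Defensive.

Import GRing.Theory.
Local Open Scope classical_set_scope.
Local Open Scope quotient_scope.
Local Open Scope ring_scope.

Local Obligation Tactic := idtac.

Record category := Category {
  obj :> Type;
  mor : obj -> obj -> Type;
  idm : forall a, mor a a;
  compm : forall a b c, mor b c -> mor a b -> mor a c;
  compm1 : forall a b (f : mor a b), compm f (idm a) = f;
  comp1m : forall a b (f : mor a b), compm (idm b) f = f;
  compmA : forall a b c d (h : mor c d) (g : mor b c) (f : mor a b),
    compm h (compm g f) = compm (compm h g) f }.
Arguments idm {_} _.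
Arguments compm {_ _ _ _} _ _.

Record functor (C D : category) := Functor {
  fobj :> C -> D;
  fmap : forall a b : C, mor a b -> mor (fobj a) (fobj b);
  fmap1 : forall a, fmap (idm a) = idm (fobj a);
  fmapM : forall a b c (g : mor b c) (f : mor a b),
    fmap (compm g f) = compm (fmap g) (fmap f) }.
Arguments fmap {_ _} _ {_ _} _.

Program Definition idf (C : category) : functor C C :=
  @Functor C C id (fun _ _ f => f) _ _.
Next Obligation. by []. Qed.
Next Obligation. by []. Qed.

Program Definition compf (C D E : category) (G : functor D E)
    (F : functor C D) : functor C E :=
  @Functor C E (fun a => G (F a)) (fun _ _ f => fmap G (fmap F f)) _ _.
Next Obligation. by move=> *; rewrite /= !fmap1. Qed.
Next Obligation. by move=> *; rewrite /= !fmapM. Qed.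

Program Definition opc (C : category) : category :=
  @Category C (fun a b => mor b a) (fun a => idm a)
    (fun _ _ _ g f => compm f g) _ _ _.
Next Obligation. by move=> *; rewrite /= comp1m. Qed.
Next Obligation. by move=> *; rewrite /= compm1. Qed.
Next Obligation. by move=> *; rewrite /= compmA. Qed.

Program Definition opf (C D : category) (F : functor C D) :
    functor (opc C) (opc D) :=
  @Functor (opc C) (opc D) F (fun _ _ f => fmap F f) _ _.
Next Obligation. by move=> C D F a; rewrite /= fmap1. Qed.
Next Obligation. by move=> C D F a b c g f; rewrite /= fmapM. Qed.

Definition is_iso (C D : category) (F : functor C D) : Prop :=
  exists2 G : functor D C, compf G F = idf C & compf F G = idf D.

Definition nat_iso (C D : category) (F G : functor C D) : Prop :=
  exists (u : forall a, mor (F a) (G a)) (v : forall a, mor (G a) (F a)),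
    [/\ forall a, compm (v a) (u a) = idm (F a),
        forall a, compm (u a) (v a) = idm (G a) &
        forall a b (f : mor a b),
          compm (u b) (fmap F f) = compm (fmap G f) (u a)].

Definition is_equiv (C D : category) (F : functor C D) (G : functor D C) :
    Prop :=
  nat_iso (compf G F) (idf C) /\ nat_iso (compf F G) (idf D).

(* [comAlgType P] consists of the nonzero algebras of the variety Com-P: its  *)
(* objects satisfy [1 != 0]. The zero algebra only arises below as the        *)
(* quotient by a total congruence, which is why quotients are not given a     *)
(* [comAlgType] structure but a [comPzRingType] and an [lmodType] structure.  *)

Section Homs.
Variable P : fieldType.

Lemma lrmorphism_ext (A B : comAlgType P) (f g : {lrmorphism A -> B}) :
  f =1 g -> f = g.
Proof.
case: f g => f [[f1] [f2] [f3]] [g [[g1] [g2] [g3]]] /= /funext fg.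
case: g / fg g1 g2 g3 => g1 g2 g3.
by rewrite (Prop_irrelevance g1 f1) (Prop_irrelevance g2 f2)
  (Prop_irrelevance g3 f3).
Qed.

Definition idh (A : comAlgType P) : {lrmorphism A -> A} := idfun.
Definition comph (A B C : comAlgType P) (g : {lrmorphism B -> C})
  (f : {lrmorphism A -> B}) : {lrmorphism A -> C} := g \o f.

Definition Ker (A B : comAlgType P) (mu : {lrmorphism A -> B}) : set (A * A) :=
  [set p | mu p.1 = mu p.2].

Record is_congruence (A : comAlgType P) (T : set (A * A)) : Prop :=
  IsCongruence {
    cong_refl : forall x, T (x, x);
    cong_sym : forall x y, T (x, y) -> T (y, x);
    cong_trans : forall x y z, T (x, y) -> T (y, z) -> T (x, z);
    congD : forall x y x' y', T (x, x') -> T (y, y') -> T (x + y, x' + y');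
    congM : forall x y x' y', T (x, x') -> T (y, y') -> T (x * y, x' * y');
    congZ : forall a x x', T (x, x') -> T (a *: x, a *: x') }.

Record congruence (A : comAlgType P) := Congruence {
  cong_set :> set (A * A);
  congP : is_congruence cong_set }.

Lemma congruence_ext (A : comAlgType P) (T U : congruence A) :
  T = U :> set (A * A) -> T = U.
Proof.
by case: T U => T hT [U hU] /= TU; subst U; rewrite (Prop_irrelevance hT hU).
Qed.

Section Quotient.
Variables (A : comAlgType P) (T : congruence A).

Definition crel : rel A := fun x y => `[< cong_set T (x, y) >].

Lemma crel_equiv : equiv_class_of crel.
Proof.
split=> [x|x y|y x z].
- exact/asboolP/(cong_refl (congP T)).
- by apply: asbool_equiv_eq; split; apply: (cong_sym (congP T)).
- move=> /asboolP xy /asboolP yz; apply/asboolP.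
  exact: (cong_trans (congP T) xy yz).
Qed.

Canonical crel_equiv_rel := EquivRelPack crel_equiv.
Canonical crel_encModRel := defaultEncModRel crel.

Definition quo := {eq_quot crel}.
HB.instance Definition _ : EqQuotient A crel quo := EqQuotient.on quo.
HB.instance Definition _ := Choice.on quo.

Lemma quoP x y : \pi_quo x = \pi_quo y <-> cong_set T (x, y).
Proof.
by split=> [/eqquotP/asboolP //|Txy]; apply/eqquotP/asboolP.
Qed.

Lemma repr_pi x : cong_set T (repr (\pi_quo x), x).
Proof. by apply/quoP; rewrite reprK. Qed.

Definition quo0 : quo := lift_cst quo 0.
Definition quo1 : quo := lift_cst quo 1.
Definition quo_add := lift_op2 quo +%R.
Definition quo_opp := lift_op1 quo -%R.
Definition quo_mul := lift_op2 quo *%R.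
Definition quo_scale (a : P) := lift_op1 quo ( *:%R a).

Canonical pi_quo0 := PiConst quo0.
Canonical pi_quo1 := PiConst quo1.

Lemma pi_add : {morph \pi : x y / x + y >-> quo_add x y}.
Proof.
move=> x y; unlock quo_add; apply/esym/quoP.
by apply: (congD (congP T)); exact: repr_pi.
Qed.
Canonical pi_add_morph := PiMorph2 pi_add.

Lemma pi_opp : {morph \pi : x / - x >-> quo_opp x}.
Proof.
move=> x; unlock quo_opp; apply/esym/quoP; rewrite -!scaleN1r.
by apply: (congZ (congP T)); exact: repr_pi.
Qed.
Canonical pi_opp_morph := PiMorph1 pi_opp.

Lemma pi_mul : {morph \pi : x y / x * y >-> quo_mul x y}.
Proof.
move=> x y; unlock quo_mul; apply/esym/quoP.
by apply: (congM (congP T)); exact: repr_pi.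
Qed.
Canonical pi_mul_morph := PiMorph2 pi_mul.

Lemma pi_scale a : {morph \pi : x / a *: x >-> quo_scale a x}.
Proof.
move=> x; unlock quo_scale; apply/esym/quoP.
by apply: (congZ (congP T)); exact: repr_pi.
Qed.
Canonical pi_scale_morph a := PiMorph1 (pi_scale a).

Let addqA : associative quo_add.
Proof. by move=> x y z; rewrite -[x]reprK -[y]reprK -[z]reprK !piE addrA. Qed.
Let addqC : commutative quo_add.
Proof. by move=> x y; rewrite -[x]reprK -[y]reprK !piE addrC. Qed.
Let add0q : left_id quo0 quo_add.
Proof. by move=> x; rewrite -[x]reprK !piE add0r. Qed.
Let addNq : left_inverse quo0 quo_opp quo_add.
Proof. by move=> x; rewrite -[x]reprK !piE addNr. Qed.
HB.instance Definition _ := GRing.isZmodule.Build quo addqA addqC add0q addNq.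

Let mulqA : associative quo_mul.
Proof. by move=> x y z; rewrite -[x]reprK -[y]reprK -[z]reprK !piE mulrA. Qed.
Let mulqC : commutative quo_mul.
Proof. by move=> x y; rewrite -[x]reprK -[y]reprK !piE mulrC. Qed.
Let mul1q : left_id quo1 quo_mul.
Proof. by move=> x; rewrite -[x]reprK !piE mul1r. Qed.
Let mulqDl : left_distributive quo_mul quo_add.
Proof. by move=> x y z; rewrite -[x]reprK -[y]reprK -[z]reprK !piE mulrDl. Qed.
HB.instance Definition _ :=
  GRing.Zmodule_isComPzRing.Build quo mulqA mulqC mul1q mulqDl.

Let scaleqA a b (x : quo) :
  quo_scale a (quo_scale b x) = quo_scale (a * b) x.
Proof. by rewrite -[x]reprK !piE scalerA. Qed.
Let scale1q : left_id 1 quo_scale.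
Proof. by move=> x; rewrite -[x]reprK !piE scale1r. Qed.
Let scaleqDr : right_distributive quo_scale quo_add.
Proof. by move=> a x y; rewrite -[x]reprK -[y]reprK !piE scalerDr. Qed.
Let scaleqDl (x : quo) a b :
  quo_scale (a + b) x = quo_add (quo_scale a x) (quo_scale b x).
Proof. by rewrite -[x]reprK !piE scalerDl. Qed.
HB.instance Definition _ :=
  GRing.Zmodule_isLmodule.Build P quo scaleqA scale1q scaleqDr scaleqDl.

Lemma piD x y : \pi_quo (x + y) = \pi_quo x + \pi_quo y.
Proof. exact: pi_add. Qed.
Lemma piM x y : \pi_quo (x * y) = \pi_quo x * \pi_quo y.
Proof. exact: pi_mul. Qed.
Lemma piZ a x : \pi_quo (a *: x) = a *: \pi_quo x.
Proof. exact: pi_scale. Qed.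
Lemma pi1 : \pi_quo 1 = 1.
Proof. by rewrite [RHS]/GRing.one /= [RHS]piE. Qed.

Lemma quo_scaleAl (a : P) (x y : quo) : a *: (x * y) = (a *: x) * y.
Proof. by rewrite -[x]reprK -[y]reprK -piM -!piZ -piM scalerAl. Qed.

End Quotient.

Record qhom (A B : comAlgType P) (T : congruence A) (U : congruence B) :=
  QHom {
    qfun :> quo T -> quo U;
    qfun_linear : linear qfun;
    qfun_monoid : monoid_morphism qfun }.

Lemma qhom_ext (A B : comAlgType P) (T : congruence A) (U : congruence B)
  (f g : qhom T U) : f =1 g -> f = g.
Proof.
case: f g => f f1 f2 [g g1 g2] /= /funext fg; case: g / fg g1 g2 => g1 g2.
by rewrite (Prop_irrelevance g1 f1) (Prop_irrelevance g2 f2).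
Qed.

Definition qid (A : comAlgType P) (T : congruence A) : qhom T T.
Proof. by exists idfun; [move=> a x y | split]. Defined.

Definition qcomp (A B C : comAlgType P) (T : congruence A) (U : congruence B)
  (V : congruence C) (g : qhom U V) (f : qhom T U) : qhom T V.
Proof.
exists (g \o f).
- by move=> a x y; rewrite /= (qfun_linear f) (qfun_linear g).
- have [f1 fM] := qfun_monoid f; have [g1 gM] := qfun_monoid g.
  by split=> [|x y]; rewrite /= ?f1 ?g1 ?fM ?gM.
Defined.

(* The homomorphism A/T -> B/U induced by s : A -> B when s maps T into U.    *)
Section QuotientMap.
Variables (A B : comAlgType P) (T : congruence A) (U : congruence B).
Variables (s : {lrmorphism A -> B}).
Hypothesis sTU : forall x y,
  cong_set T (x, y) -> cong_set U (s x, s y).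

Definition qmap_fun (x : quo T) : quo U := \pi_(quo U) (s (repr x)).

Lemma qmap_funE x : qmap_fun (\pi_(quo T) x) = \pi_(quo U) (s x).
Proof. by apply/quoP/sTU/repr_pi. Qed.

Definition qmap : qhom T U.
Proof.
exists qmap_fun.
- move=> a x y; rewrite -[x]reprK -[y]reprK -piZ -piD !qmap_funE.
  by rewrite linearP piD piZ.
- split=> [|x y]; first by rewrite -pi1 qmap_funE rmorph1 pi1.
  by rewrite -[x]reprK -[y]reprK -piM !qmap_funE rmorphM piM.
Defined.

Lemma qmapE x : qmap (\pi_(quo T) x) = \pi_(quo U) (s x).
Proof. exact: qmap_funE. Qed.

End QuotientMap.

End Homs.

Section Theta0.
Variables (P : fieldType) (X0 : choiceType).
Implicit Types X Y : {fset X0}.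

(* W(X) = P[X]; the free generator x \in X is the variable of index i, where  *)
(* x is the i-th element of the duplicate-free sequence underlying X. The     *)
(* objects of the category below are the sets X themselves, so that distinct  *)
(* X give distinct objects W(X), even when they have the same cardinality.    *)
Definition W X : comAlgType P := {mpoly P[#|` X|]}.

Program Definition Theta0 : category :=
  @Category {fset X0} (fun X Y => {lrmorphism W X -> W Y})
    (fun X => idh (W X)) (fun _ _ _ g f => comph g f) _ _ _.
Next Obligation. by move=> *; apply: lrmorphism_ext. Qed.
Next Obligation. by move=> *; apply: lrmorphism_ext. Qed.
Next Obligation. by move=> *; apply: lrmorphism_ext. Qed.

End Theta0.
Arguments W {P X0} X.

Section Galois.
Variables (P : fieldType) (X0 : choiceType) (H : comAlgType P).
Implicit Types X Y : {fset X0}.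

Definition galT X (T : set (W X * W X)) : set {lrmorphism W X -> H} :=
  [set mu | T `<=` Ker mu].

Definition galA X (A : set {lrmorphism W X -> H}) : set (W X * W X) :=
  \bigcap_(mu in A) Ker mu.

Definition algebraic X (A : set {lrmorphism W X -> H}) : Prop :=
  exists T, A = galT T.

Definition Hclosed X (T : set (W X * W X)) : Prop :=
  exists A : set {lrmorphism W X -> H}, T = galA A.

Lemma galA_congruence X (A : set {lrmorphism W X -> H}) :
  is_congruence (galA A).
Proof.
split=> [x mu _ //|x y xy mu Amu|x y z xy yz mu Amu|x y x' y' xx yy mu Amu
  |x y x' y' xx yy mu Amu|a x x' xx mu Amu]; rewrite /Ker /=.
- by rewrite (xy _ Amu).
- by rewrite (xy _ Amu : mu x = mu y) (yz _ Amu).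
- by rewrite !rmorphD; congr (_ + _); [exact: xx|exact: yy].
- by rewrite !rmorphM; congr (_ * _); [exact: xx|exact: yy].
- by rewrite !linearZ_LR; congr (_ *: _); exact: xx.
Qed.

Definition galA_cong X (A : set {lrmorphism W X -> H}) : congruence (W X) :=
  Congruence (galA_congruence A).

End Galois.
Arguments galT {P X0} H {X} T.

Section Categories.
Variables (P : fieldType) (X0 : choiceType) (H : comAlgType P).
Implicit Types X Y : {fset X0}.

(* Morphisms of K0(H) and K(H) are maps, for which some underlying            *)
(* homomorphism s exists; distinct s may give the same morphism.              *)
Record k0hom X Y := K0Hom {
  k0fun :> {lrmorphism W X -> H} -> {lrmorphism W Y -> H};
  k0P : exists s : {lrmorphism W Y -> W X}, forall nu, k0fun nu = comph nu s }.

Lemma k0hom_ext X Y (f g : k0hom X Y) : f =1 g -> f = g.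
Proof.
case: f g => f f1 [g g1] /= /funext fg; case: g / fg g1 => g1.
by rewrite (Prop_irrelevance g1 f1).
Qed.

Definition k0id X : k0hom X X.
Proof. by exists idfun; exists (idh _) => nu; apply: lrmorphism_ext. Defined.

Definition k0comp X Y Z (g : k0hom Y Z) (f : k0hom X Y) : k0hom X Z.
Proof.
exists (g \o f); have [t gt] := k0P g; have [s fs] := k0P f.
by exists (comph s t) => nu; rewrite /= gt fs; apply: lrmorphism_ext.
Defined.

Program Definition K0Theta : category :=
  @Category {fset X0} k0hom k0id (fun _ _ _ g f => k0comp g f) _ _ _.
Next Obligation. by move=> *; apply: k0hom_ext. Qed.
Next Obligation. by move=> *; apply: k0hom_ext. Qed.
Next Obligation. by move=> *; apply: k0hom_ext. Qed.

Record kobj := KObj {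
  kX : {fset X0};
  kA : set {lrmorphism W kX -> H};
  kAP : algebraic kA }.
Arguments kA _ _ : clear implicits.

Record khom (a b : kobj) := KHom {
  kfun :> kA a -> kA b;
  kP : exists s : {lrmorphism W (kX b) -> W (kX a)},
    forall nu : kA a, val (kfun nu) = comph (val nu) s }.

Lemma khom_ext a b (f g : khom a b) : f =1 g -> f = g.
Proof.
case: f g => f f1 [g g1] /= /funext fg; case: g / fg g1 => g1.
by rewrite (Prop_irrelevance g1 f1).
Qed.

Definition kid a : khom a a.
Proof. by exists idfun; exists (idh _) => nu; apply: lrmorphism_ext. Defined.

Definition kcomp a b c (g : khom b c) (f : khom a b) : khom a c.
Proof.
exists (g \o f); have [t gt] := kP g; have [s fs] := kP f.
by exists (comph s t) => nu; rewrite /= gt fs; apply: lrmorphism_ext.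
Defined.

Program Definition KTheta : category :=
  @Category kobj khom kid (fun _ _ _ g f => kcomp g f) _ _ _.
Next Obligation. by move=> *; apply: khom_ext. Qed.
Next Obligation. by move=> *; apply: khom_ext. Qed.
Next Obligation. by move=> *; apply: khom_ext. Qed.

Record cobj := CObj {
  cX : {fset X0};
  cT : congruence (W cX);
  cTP : Hclosed H cT }.

Program Definition CTheta : category :=
  @Category cobj (fun a b => qhom (cT a) (cT b)) (fun a => qid (cT a))
    (fun _ _ _ g f => qcomp g f) _ _ _.
Next Obligation. by move=> *; apply: qhom_ext. Qed.
Next Obligation. by move=> *; apply: qhom_ext. Qed.
Next Obligation. by move=> *; apply: qhom_ext. Qed.

(* The inclusion of K0(H) in K(H): Hom(W(X),H) is the algebraic set of the    *)
(* empty T.                                                                   *)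
Lemma algebraicT X : algebraic [set: {lrmorphism W X -> H}].
Proof. by exists set0; apply/seteqP; split=> mu _ // p []. Qed.

Definition inclK_hom X Y (f : k0hom X Y) :
  khom (KObj (algebraicT X)) (KObj (algebraicT Y)).
Proof.
exists (fun nu => exist _ (f (val nu)) (mem_set I)).
by have [s fs] := k0P f; exists s => nu; rewrite /= fs.
Defined.

Program Definition inclK : functor K0Theta KTheta :=
  @Functor K0Theta KTheta (fun X => KObj (algebraicT X)) inclK_hom _ _.
Next Obligation. by move=> X; apply: khom_ext => nu; apply: val_inj. Qed.
Next Obligation. by move=> *; apply: khom_ext => nu; apply: val_inj. Qed.

(* The duality K(H) -> C(H): (X, A) |-> W(X)/A', and the morphism             *)
(* (X, A) -> (Y, B) given by s : W(Y) -> W(X) is sent to the homomorphism     *)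
(* W(Y)/B' -> W(X)/A' induced by s, which does not depend on the choice of s. *)
Definition dual_obj (a : kobj) : cobj :=
  @CObj (kX a) (galA_cong (kA a)) (ex_intro _ (kA a) erefl).

Definition khom_rep a b (f : khom a b) : {lrmorphism W (kX b) -> W (kX a)} :=
  projT1 (cid (kP f)).

Lemma khom_repP a b (f : khom a b) (nu : kA a) :
  val (f nu) = comph (val nu) (khom_rep f).
Proof. by rewrite /khom_rep; case: cid => s /= ->. Qed.

Lemma khom_gal a b (f : khom a b) (s : {lrmorphism W (kX b) -> W (kX a)}) :
  (forall nu : kA a, val (f nu) = comph (val nu) s) ->
  forall x y, galA (kA b) (x, y) -> galA (kA a) (s x, s y).
Proof.
move=> fs x y Bxy nu Anu; pose nu' : kA a := exist _ nu (mem_set Anu).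
have := Bxy _ (set_mem (valP (f nu'))).
by rewrite fs.
Qed.

Definition dual_hom a b (f : khom a b) :
    qhom (cT (dual_obj b)) (cT (dual_obj a)) :=
  @qmap P (W (kX b)) (W (kX a)) (cT (dual_obj b)) (cT (dual_obj a))
    (khom_rep f) (khom_gal (khom_repP f)).

Lemma dual_homE a b (f : khom a b) (s : {lrmorphism W (kX b) -> W (kX a)}) :
  (forall nu : kA a, val (f nu) = comph (val nu) s) ->
  forall x, dual_hom f (\pi_(quo (cT (dual_obj b))) x) =
            \pi_(quo (cT (dual_obj a))) (s x).
Proof.
move=> fs x; rewrite /dual_hom qmapE; apply/quoP => nu Anu.
have := khom_repP f (exist _ nu (mem_set Anu)).
by rewrite fs => /(congr1 (fun mu : {lrmorphism _ -> _} => mu x)).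
Qed.

Program Definition dual : functor KTheta (opc CTheta) :=
  @Functor KTheta (opc CTheta) dual_obj dual_hom _ _.
Next Obligation.
move=> a; apply: qhom_ext => x; rewrite -[x]reprK.
by rewrite (@dual_homE _ _ _ (idh _)) // => nu; apply: lrmorphism_ext.
Qed.
Next Obligation.
move=> a b c g f; apply: qhom_ext => x; rewrite -[x]reprK; apply/esym.
transitivity (dual_hom f (\pi_(quo (cT (dual_obj b))) (khom_rep g (repr x)))).
  by congr (dual_hom f _); apply/dual_homE/khom_repP.
rewrite (dual_homE (khom_repP f)).
rewrite (@dual_homE _ _ _ (comph (khom_rep f) (khom_rep g))) // => nu.
by rewrite /= !khom_repP; apply: lrmorphism_ext.
Qed.

End Categories.

Section InfiniteField.
Variable P : fieldType.
Hypothesis P_inf : infinite_set [set: P].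

Let widen n := widen_ord (leqnSn n).

Lemma muni_horner n (S : comNzRingType) (f : {rmorphism {mpoly P[n]} -> S}) u
    (p : {mpoly P[n.+1]}) :
  (map_poly f (muni p)).[u] =
  \sum_(m <- msupp p)
    f (p@_m *: 'X_[[multinom (m (widen i)) | i < n]]) * u ^+ m ord_max.
Proof.
rewrite muniE rmorph_sum horner_sum; apply: eq_bigr => m _.
by rewrite -mul_polyC rmorphM /= map_polyC map_polyXn hornerM hornerC hornerXn.
Qed.

Lemma muni_inj0 n (p : {mpoly P[n.+1]}) : muni p = 0 -> p = 0.
Proof.
move=> p0; have := @muni_horner n _ (@mwiden n P) 'X_ord_max p.
rewrite p0 rmorph0 horner0 => /esym E; rewrite [LHS]mpolyE -[RHS]E.
apply: eq_bigr => m _; rewrite /= mwidenZ -scalerAl mwidenX.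
rewrite mpolyXn -mpolyXD; congr (_ *: 'X_[_]); apply/mnmP => i.
rewrite mnmDE mulmnE mnm1E.
case: (unliftP ord_max i) => [j ->|->].
  have -> : lift ord_max j = widen j by apply: val_inj; exact: lift_max.
  by rewrite mnmwiden_widen mnmE eq_sym -val_eqE /= ltn_eqF ?ltn_ord //
    mul0n addn0.
by rewrite mnmwiden_ordmax eqxx mul1n add0n.
Qed.

Lemma muni_meval n (v : 'I_n.+1 -> P) (p : {mpoly P[n.+1]}) :
  (map_poly (meval (fun i => v (widen i))) (muni p)).[v ord_max] = p.@[v].
Proof.
rewrite muni_horner mevalE; apply: eq_bigr => m _.
rewrite /= mevalZ mevalX big_ord_recr /= mulrA; congr (_ * _ * _).
by apply: eq_bigr => i _; rewrite mnmE.
Qed.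

Lemma poly_eval0 (q : {poly P}) : (forall t, q.[t] = 0) -> q = 0.
Proof.
move=> q0; have [B _ Bq] := infinite_set_fset (size q) P_inf.
apply: (@roots_geq_poly_eq0 _ q (enum_fset B)) => //; last exact: fset_uniq.
by apply/allP => t _; rewrite /root q0.
Qed.

Lemma mpoly_eval0 n (p : {mpoly P[n]}) : (forall v, p.@[v] = 0) -> p = 0.
Proof.
elim: n p => [|n IHn] p p0.
  by move: (p0 (fun=> 0)); rewrite [p]nvar0_mpolyC mevalC => ->; rewrite mpolyC0.
apply: muni_inj0; apply/polyP => k; rewrite coef0; apply: IHn => v.
pose vt t (i : 'I_n.+1) :=
  if unlift ord_max i is Some j then v (cast_ord erefl j) else t.
have vtE t i : vt t (widen i) = v i.
  have -> : widen i = lift ord_max i by apply/esym/val_inj; exact: lift_max.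
  by rewrite /vt liftK; congr v; apply: val_inj.
have /polyP/(_ k) : map_poly (meval v) (muni p) = 0.
  apply: poly_eval0 => t; rewrite -(p0 (vt t)) -muni_meval.
  rewrite /vt unlift_none; congr horner; apply: eq_map_poly => r.
  by apply: meval_eq => i; rewrite -(vtE t).
by rewrite coef_map coef0.
Qed.

End InfiniteField.

Section Inclusion.
Variables (P : fieldType) (X0 : choiceType) (H : comAlgType P).
Hypothesis P_inf : infinite_set [set: P].
Implicit Types X Y : {fset X0}.

Section Scalars.
Variables (X : {fset X0}) (v : 'I_#|` X| -> P).
Definition scal_eval (p : W X) : H := (p.@[v])%:A.
Lemma scal_eval_linear : linear scal_eval.
Proof.
by move=> a p q; rewrite /scal_eval mevalD mevalZ scalerDl scalerA.
Qed.
Lemma scal_eval_monoid : monoid_morphism scal_eval.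
Proof.
split=> [|p q]; first by rewrite /scal_eval meval1 scale1r.
by rewrite /scal_eval mevalM -scalerAl mul1r scalerA.
Qed.
HB.instance Definition _ :=
  GRing.isLinear.Build P (W X) H _ scal_eval scal_eval_linear.
HB.instance Definition _ :=
  GRing.isMonoidMorphism.Build (W X) H scal_eval scal_eval_monoid.
Definition scal_evalh : {lrmorphism W X -> H} := scal_eval.
End Scalars.

Definition diag (A : comAlgType P) : set (A * A) := [set p | p.1 = p.2].

Lemma diag_congruence (A : comAlgType P) : is_congruence (@diag A).
Proof. by split=> //=; rewrite /diag /= => *; congruence. Qed.

Definition diag_cong (A : comAlgType P) : congruence A :=
  Congruence (@diag_congruence A).

(* The trivial congruence is H-closed, that is, Var(H) = Com-P: this is where *)
(* the infiniteness of P is used.                                             *)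
Lemma diag_closed X : Hclosed H (diag_cong (W X)).
Proof.
exists setT; apply/seteqP; split=> [[p q] pq mu _|[p q] pq].
  by rewrite /Ker /= (pq : p = q).
apply: subr0_eq; apply: (mpoly_eval0 P_inf) => v.
have := pq (scal_evalh v) I; rewrite /Ker /= /scal_eval => /eqP.
rewrite mevalB -subr_eq0 -scalerBl scaler_eq0 oner_eq0 orbF => /eqP //.
Qed.

Definition inclC_obj X : cobj X0 H := @CObj _ _ _ X _ (diag_closed X).

Lemma diag_map (A B : comAlgType P) (s : {lrmorphism A -> B}) x y :
  diag (x, y) -> diag (s x, s y).
Proof. by rewrite /diag /= => ->. Qed.

Definition inclC_hom X Y (s : {lrmorphism W X -> W Y}) :
    qhom (diag_cong (W X)) (diag_cong (W Y)) :=
  @qmap P (W X) (W Y) (diag_cong (W X)) (diag_cong (W Y)) s (@diag_map _ _ s).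

Lemma inclC_homE X Y (s : {lrmorphism W X -> W Y}) x :
  inclC_hom s (\pi_(quo (diag_cong (W X))) x) =
  \pi_(quo (diag_cong (W Y))) (s x).
Proof. exact: qmapE. Qed.

Program Definition inclC : functor (Theta0 P X0) (CTheta X0 H) :=
  @Functor (Theta0 P X0) (CTheta X0 H) inclC_obj (fun _ _ s => inclC_hom s) _ _.
Next Obligation.
by move=> X; apply: qhom_ext => x; rewrite -[RHS]reprK.
Qed.
Next Obligation.
move=> X Y Z t s; apply: qhom_ext => x; rewrite -[x]reprK; apply/esym.
transitivity (inclC_hom t (\pi_(quo (diag_cong (W Y))) (s (repr x)))).
  by congr (inclC_hom t _); exact: inclC_homE.
by rewrite inclC_homE; apply/esym; exact: inclC_homE.
Qed.

End Inclusion.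

Section Correct.
Variables (P : fieldType) (X0 : choiceType).
Hypothesis P_inf : infinite_set [set: P].

(* Phi corresponds to F when D2 F = Phi D1, where D1, D2 are the dualities    *)
(* K(H) -> C(H); as these are invertible, F has exactly one such Phi, namely  *)
(* D2 F D1^-1.                                                                *)
Definition corresponding (H1 H2 : comAlgType P)
    (F : functor (KTheta X0 H1) (KTheta X0 H2))
    (Phi : functor (CTheta X0 H1) (CTheta X0 H2)) : Prop :=
  compf (dual X0 H2) F = compf (opf Phi) (dual X0 H1).

Definition induces_Theta0 (H1 H2 : comAlgType P)
    (Phi : functor (CTheta X0 H1) (CTheta X0 H2))
    (phi : functor (Theta0 P X0) (Theta0 P X0)) : Prop :=
  compf (inclC X0 H2 P_inf) phi = compf Phi (inclC X0 H1 P_inf).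

Definition induces_K0 (H1 H2 : comAlgType P)
    (F : functor (KTheta X0 H1) (KTheta X0 H2))
    (F0 : functor (K0Theta X0 H1) (K0Theta X0 H2)) : Prop :=
  compf (inclK X0 H2) F0 = compf F (inclK X0 H1).

(* kle (X, A) (Y, B) holds when X = Y and A is included in B. *)
Inductive kle (H : comAlgType P) : kobj X0 H -> kobj X0 H -> Prop :=
  KLe (X : {fset X0}) (A B : set {lrmorphism W X -> H})
      (hA : algebraic A) (hB : algebraic B) :
    A `<=` B -> kle (KObj hA) (KObj hB).

Definition incl_preserving (H1 H2 : comAlgType P)
    (F : functor (KTheta X0 H1) (KTheta X0 H2)) : Prop :=
  forall a b, kle a b -> kle (F a) (F b).

Definition correct_iso (H1 H2 : comAlgType P)
    (F : functor (KTheta X0 H1) (KTheta X0 H2)) : Prop :=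
  [/\ is_iso F,
      exists Phi, [/\ corresponding F Phi, is_iso Phi &
        exists2 phi, induces_Theta0 Phi phi & is_iso phi],
      exists2 F0, induces_K0 F F0 & is_iso F0 &
      incl_preserving F].

Definition correct_equiv (H1 H2 : comAlgType P)
    (F1 : functor (KTheta X0 H1) (KTheta X0 H2))
    (F2 : functor (KTheta X0 H2) (KTheta X0 H1)) : Prop :=
  [/\ is_equiv F1 F2,
      exists Phi1 Phi2, [/\ corresponding F1 Phi1, corresponding F2 Phi2 &
        exists phi psi, [/\ induces_Theta0 Phi1 phi, induces_Theta0 Phi2 psi &
          is_equiv phi psi]],
      exists G1 G2, [/\ induces_K0 F1 G1, induces_K0 F2 G2 & is_equiv G1 G2] &
      incl_preserving F1 /\ incl_preserving F2].

Definition correctly_isomorphic (H1 H2 : comAlgType P) : Prop :=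
  exists F : functor (KTheta X0 H1) (KTheta X0 H2), correct_iso F.

Definition correctly_equivalent (H1 H2 : comAlgType P) : Prop :=
  exists (F1 : functor (KTheta X0 H1) (KTheta X0 H2))
         (F2 : functor (KTheta X0 H2) (KTheta X0 H1)),
    correct_equiv F1 F2.

End Correct.

Record field_aut (P : fieldType) := FieldAut {
  aut :> {rmorphism P -> P};
  aut_inv : {rmorphism P -> P};
  autK : cancel aut aut_inv;
  aut_invK : cancel aut_inv aut }.

(* H^sigma: the scalar a acts as sigma^-1(a). *)
Definition twist (P : fieldType) (sigma : field_aut P) (H : comAlgType P) :
  Type := H.

Section Twist.
Variables (P : fieldType) (sigma : field_aut P) (H : comAlgType P).
Local Notation twist := (twist sigma H).

HB.instance Definition _ := GRing.ComNzRing.on twist.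

Definition twist_scale (a : P) (x : twist) : twist := aut_inv sigma a *: (x : H).

Let twist_scaleA a b (x : twist) :
  twist_scale a (twist_scale b x) = twist_scale (a * b) x.
Proof. by rewrite /twist_scale rmorphM scalerA. Qed.
Let twist_scale1 : left_id 1 twist_scale.
Proof. by move=> x; rewrite /twist_scale rmorph1 scale1r. Qed.
Let twist_scaleDr : right_distributive twist_scale +%R.
Proof. by move=> a x y; rewrite /twist_scale scalerDr. Qed.
Let twist_scaleDl (x : twist) : {morph twist_scale^~ x : a b / a + b}.
Proof. by move=> a b; rewrite /twist_scale rmorphD scalerDl. Qed.
HB.instance Definition _ := GRing.Zmodule_isLmodule.Build P twist
  twist_scaleA twist_scale1 twist_scaleDr twist_scaleDl.

Let twist_scaleAl (a : P) (x y : twist) : a *: (x * y) = (a *: x) * y.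
Proof. exact: (scalerAl (aut_inv sigma a) (x : H) (y : H)). Qed.
HB.instance Definition _ := GRing.Lmodule_isLalgebra.Build P twist twist_scaleAl.
HB.instance Definition _ := GRing.Lalgebra_isComAlgebra.Build P twist.

End Twist.

Definition geom_equiv (P : fieldType) (X0 : choiceType)
    (H1 H2 : comAlgType P) : Prop :=
  forall (X : {fset X0}) (T : set (W X * W X)),
    galA (galT H1 T) = galA (galT H2 T).

Definition twisted_geom_equiv (P : fieldType) (X0 : choiceType)
    (H1 H2 : comAlgType P) : Prop :=
  exists sigma : field_aut P, geom_equiv X0 (twist sigma H1) H2.

(* Main.v *)
Require Import Defs.
From HB Require Import structures.
From mathcomp Require Import all_boot all_algebra finmap.
From mathcomp Require Import boolp classical_sets cardinality.
From mathcomp Require Import mpoly.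

Set Implicit Arguments.
Unset Strict Implicit.
Unset Printing Implicit Defensive.

Import GRing.Theory.
Local Open Scope classical_set_scope.
Local Open Scope quotient_scope.
Local Open Scope ring_scope.

Local Obligation Tactic := idtac.

(** Both correctness notions give functors [Phi1], [Phi2] between the
    categories [C(H1)] and [C(H2)] that extend an autoequivalence [phi] of the
    category of polynomial algebras [W X]. Two facts then force [H1] and [H2]
    to have the same closed congruences up to a twist of the coefficients.

    The autoequivalence [phi] is semi-inner ([semi_inner]): up to linear
    isomorphisms [W X ~ W (phi X)], it conjugates every substitution by a field
    automorphism [sigma] acting on coefficients. Constant morphisms, and hence
    the line [P[t]], have a purely categorical description ([equiv_constm],
    [line_one], [line_card]), so [phi] permutes the constants of [P[t]] by a
    bijection [tau] of [P]. The automorphisms of [P[t]] are affine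
    ([auto_affine]), so [tau] normalises the group of affine maps, and such a
    bijection is a field automorphism up to an affine map
    ([semiaffine_field_aut]). The evaluation of an element of [W (phi X)] at a
    point is given by [tau], and over an infinite field points separate
    polynomials, so all of [phi] is determined.

    A faithful extension [Phi] of [phi] preserves closed congruences
    ([kernel_transport]): if [T] is closed, it is the kernel of a morphism
    [W X -> W X / T] of [C(H1)], the image of that morphism under [Phi] is some
    homomorphism from [W (phi X)] to an object of [C(H2)], and the kernel of a
    homomorphism to such an object is closed ([qhom_kernel_closed]).
    Together, [T |-> sigma T] maps the [H1]-closed congruences onto the
    [H2]-closed ones ([induced_same_closed]), which means that the twist of
    [H1] by [sigma] is geometrically equivalent to [H2]
    ([twisted_geom_equivP]).

    Conversely, if closed congruences correspond under [sigma], conjugation by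
    [sigma] defines functors on all the categories involved; the functors for
    [sigma] and for its inverse are strictly inverse to each other, and they
    give a correct isomorphism and a correct equivalence at once
    ([twisted_correct]). *)

(** * Polynomial algebras as free algebras *)

Section FreeAlgebra.
Variables (P : fieldType) (X0 : choiceType).
Local Notation W := (@W P X0).
Implicit Types (X Y Z : {fset X0}) (A B : comAlgType P).

Lemma hom_scalar A B (f : {lrmorphism A -> B}) c : f c%:A = c%:A.
Proof. by rewrite linearZ /= rmorph1. Qed.

Lemma hom_affine A B (f : {lrmorphism A -> B}) (a b : P) x :
  f (a *: x + b%:A) = a *: f x + b%:A.
Proof. by rewrite linearP /= hom_scalar. Qed.

Section Substitution.
Variables (X : {fset X0}) (A : comAlgType P) (a : 'I_#|` X| -> A).

Definition subst_fun (p : W X) : A := mmap (in_alg A) a p.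

Lemma subst_linear : linear subst_fun.
Proof.
by move=> c p q; rewrite /subst_fun mmapD mmapZ /= -scalerAl mul1r.
Qed.

Lemma subst_monoid : monoid_morphism subst_fun.
Proof. by split=> [|p q]; rewrite /subst_fun ?rmorph1 ?rmorphM. Qed.

HB.instance Definition _ :=
  GRing.isLinear.Build P (W X) A _ subst_fun subst_linear.
HB.instance Definition _ :=
  GRing.isMonoidMorphism.Build (W X) A subst_fun subst_monoid.

Definition subst : {lrmorphism W X -> A} := subst_fun.

Lemma substX i : subst 'X_i = a i.
Proof. by rewrite /subst /= /subst_fun mmapX mmap1U. Qed.

End Substitution.

Lemma hom_eq X A (f g : {lrmorphism W X -> A}) :
  (forall i, f 'X_i = g 'X_i) -> f = g.
Proof.
move=> fg; apply: lrmorphism_ext => p.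
elim/mpolyind: p => [|c m p _ _ IHp]; first by rewrite !linear0.
have -> : f (c *: 'X_[m] + p) = c *: f 'X_[m] + f p by exact: linearP.
have -> : g (c *: 'X_[m] + p) = c *: g 'X_[m] + g p by exact: linearP.
rewrite IHp mpolyXE_id; congr (_ *: _ + _).
rewrite (rmorph_prod f) (rmorph_prod g).
apply: eq_bigr => i _; rewrite (rmorphXn f) (rmorphXn g).
by congr (_ ^+ _); exact: fg.
Qed.

Lemma scal_evalh_subst X A (v : 'I_#|` X| -> P) :
  scal_evalh A v = subst (fun i => (v i)%:A).
Proof.
by apply: hom_eq => i; rewrite substX /= /scal_eval mevalXU.
Qed.

Lemma scal_evalhE X A (v : 'I_#|` X| -> P) p :
  scal_evalh A v p = (p.@[v])%:A.
Proof. by []. Qed.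

Lemma meval_alg X (v : 'I_#|` X| -> P) c : (c%:A : W X).@[v] = c.
Proof. by rewrite mevalZ meval1 mulr1. Qed.

Lemma alg_inj A : injective (in_alg A).
Proof. exact: fmorph_inj. Qed.

End FreeAlgebra.

(** * Constant morphisms and lines under an equivalence *)

Definition faithful (C D : category) (F : functor C D) : Prop :=
  forall (a b : C) (f g : mor a b), fmap F f = fmap F g -> f = g.

Definition full (C D : category) (F : functor C D) : Prop :=
  forall (a b : C) (h : mor (F a) (F b)), exists f : mor a b, fmap F f = h.

(** In the category of polynomial algebras these are the homomorphisms with
    values in the scalars, which are the points of the source. *)
Definition constm (C : category) (a b : C) (f : mor a b) : Prop :=
  forall (c : C) (g h : mor b c), compm g f = compm h f.

(** A categorical description of [P[t]]: a polynomial idempotent under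
    composition is constant or [t], while in two or more variables there are
    projections onto a coordinate line. *)
Definition line_like (C : category) (a : C) : Prop :=
  ~ constm (idm a) /\
  forall e : mor a a, compm e e = e -> constm e \/ e = idm a.

Lemma nat_iso_faithful (C D : category) (F : functor C D) (G : functor D C) :
  nat_iso (compf G F) (idf C) -> faithful F.
Proof.
move=> [u [v [vu uv nat]]] a b f g fg.
rewrite -[f]compm1 -[g]compm1 -!(uv a) !compmA.
by move: (nat _ _ f) (nat _ _ g) => /= <- <-; rewrite fg.
Qed.

Section Equivalence.
Variables (C D : category) (F : functor C D) (G : functor D C).
Hypothesis FG : is_equiv F G.

Lemma equiv_faithful : faithful F.
Proof. by case: FG => GF _; exact: nat_iso_faithful GF. Qed.

Lemma equiv_full : full F.
Proof.
case: FG => [[u [v [vu uv nat]]] FGi] a b h.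
pose f : mor a b := compm (u b) (compm (fmap G h) (v a)); exists f.
apply: (nat_iso_faithful FGi).
have := nat _ _ f; rewrite /= /f => natf.
rewrite -[LHS]comp1m -vu -compmA natf -!compmA (compmA (v b)) vu comp1m.
by rewrite vu compm1.
Qed.

Lemma equiv_constm (a b : C) (f : mor a b) : constm (fmap F f) <-> constm f.
Proof.
split=> cf c g h.
  by apply: equiv_faithful; rewrite !fmapM; exact: cf.
case: (FG) => _ [u [v [vu uv nat]]].
have [g' g'E] := equiv_full (compm (v c) g).
have [h' h'E] := equiv_full (compm (v c) h).
rewrite -[g]comp1m -[h]comp1m -(uv c) -!compmA; congr compm.
by rewrite !compmA -g'E -h'E -!fmapM (cf _ g' h').
Qed.

Lemma equiv_line (a : C) : line_like a -> line_like (F a).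
Proof.
case=> ida idem; split=> [|e ee]; first by rewrite -fmap1 equiv_constm.
have [e' e'E] := equiv_full e; subst e.
rewrite equiv_constm -fmap1.
have [|e'c|->] := idem e'; [|by left|by right].
by apply: equiv_faithful; rewrite fmapM.
Qed.

End Equivalence.

Section Lines.
Variables (P : fieldType) (X0 : choiceType).
Local Notation W := (@W P X0).
Implicit Types (X Y Z : {fset X0}).
Local Notation C := (Theta0 P X0).

Lemma scal_evalh_constm X Y (f : {lrmorphism W X -> W Y}) v :
  f = scal_evalh (W Y) v -> @constm C X Y f.
Proof.
move=> -> Z g h; apply: lrmorphism_ext => p.
by rewrite /= /scal_eval !hom_scalar.
Qed.

Lemma constm_scal_evalh X Y (f : {lrmorphism W X -> W Y}) :
  @constm C X Y f -> exists v, f = scal_evalh (W Y) v.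
Proof.
move=> cf; exists (fun i => (f 'X_i).@[fun=> 0]).
rewrite scal_evalh_subst; apply: hom_eq => i; rewrite substX.
(* The identity and the evaluation at the origin agree after a constant f. *)
have /(congr1 (fun g : {lrmorphism W X -> W Y} => g 'X_i)) :=
  cf Y (idh (W Y)) (scal_evalh (W Y) (fun=> 0)).
by [].
Qed.

Lemma var_neq_scalar X i (c : P) : 'X_i <> c%:A :> W X.
Proof.
move=> /(congr1 (meval (fun=> c + 1))); rewrite mevalXU meval_alg => /eqP.
by rewrite -subr_eq0 addrAC subrr add0r oner_eq0.
Qed.

Section OneVariable.
Variables (Z : {fset X0}) (Z1 : #|` Z| = 1%N).

Definition var : 'I_#|` Z| := cast_ord (esym Z1) ord0.

Lemma all_var i : i = var.
Proof. by apply: (can_inj (cast_ordK Z1)); rewrite ord1 [RHS]ord1. Qed.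

Definition elt_hom (A : comAlgType P) (w : A) : {lrmorphism W Z -> A} :=
  subst (fun=> w).

Lemma elt_homE (A : comAlgType P) (w : A) : elt_hom w 'X_var = w.
Proof. exact: substX. Qed.

Lemma hom_var_eq (A : comAlgType P) (f g : {lrmorphism W Z -> A}) :
  f 'X_var = g 'X_var -> f = g.
Proof. by move=> fg; apply: hom_eq => i; rewrite (all_var i). Qed.

(** Univariate polynomials carry the degree theory of composition. *)
Definition upoly : {lrmorphism W Z -> {poly P}} := elt_hom 'X.

Lemma upolyX : upoly 'X_var = 'X. Proof. exact: elt_homE. Qed.

Lemma upoly_elt_hom (q p : W Z) : upoly (elt_hom q p) = upoly p \Po upoly q.
Proof.
pose f : {lrmorphism W Z -> {poly P}} := comph upoly (elt_hom q).
pose g : {lrmorphism W Z -> {poly P}} :=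
  comph (comp_poly (upoly q) : {lrmorphism {poly P} -> {poly P}}) upoly.
have -> : upoly (elt_hom q p) = f p by [].
have -> : upoly p \Po upoly q = g p by [].
congr ((_ : {lrmorphism _ -> _}) p); apply: hom_var_eq.
rewrite -[LHS]/(upoly (elt_hom q 'X_var)) -[RHS]/(upoly 'X_var \Po upoly q).
by rewrite elt_homE upolyX comp_polyX.
Qed.

Lemma horner_upoly p c : (upoly p).[c] = p.@[fun=> c].
Proof.
(* Evaluation is composition with a constant polynomial. *)
apply: polyC_inj; rewrite -comp_polyCr -[c%:P]mulr1 mul_polyC.
rewrite -[c%:A](hom_scalar upoly) -upoly_elt_hom -[RHS]mulr1 mul_polyC.
rewrite -(hom_scalar upoly); congr (upoly _).
by rewrite -(scal_evalhE (W Z)) scal_evalh_subst.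
Qed.

Hypothesis P_inf : infinite_set [set: P].

Lemma upoly_inj : injective upoly.
Proof.
move=> p q pq; apply: subr0_eq; apply: (mpoly_eval0 P_inf) => v.
have -> : v = fun=> v var by apply/funext => i; rewrite (all_var i).
by rewrite mevalB -!horner_upoly pq subrr.
Qed.

Lemma upoly_const p c : upoly p = c%:P -> p = c%:A.
Proof.
move=> pc; apply: upoly_inj.
rewrite pc -[LHS]mulr1 mul_polyC; exact/esym/(hom_scalar upoly).
Qed.

(** Degrees multiply under composition, so a polynomial with a compositional
    inverse has degree one. *)
Lemma auto_affine (f g : {lrmorphism W Z -> W Z}) :
  @compm C Z Z Z f g = @idm C Z ->
  exists a b, forall c, (f 'X_var).@[fun=> c] = a * c + b.
Proof.
set q := f 'X_var; move=> fg.
have : upoly (g 'X_var) \Po upoly q = 'X.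
  have -> : upoly q = upoly (f 'X_var) by [].
  rewrite -upoly_elt_hom -upolyX; congr (upoly _).
  rewrite -[RHS]/(@idm C Z 'X_var) -fg.
  by have -> : elt_hom q = f by apply: hom_var_eq; rewrite elt_homE.
move=> /(congr1 (fun r : {poly P} => (size r).-1)).
rewrite size_comp_poly size_polyX /= => /eqP.
rewrite muln_eq1 => /andP[_ /eqP q2].
exists (upoly q)`_1, (upoly q)`_0 => c.
have qs : (size (upoly q) <= 2)%N by case: (size _) q2 => [|[|[]]].
rewrite -horner_upoly (horner_coef_wide _ qs) !big_ord_recl big_ord0 /=.
by rewrite expr0 mulr1 addr0 expr1 addrC.
Qed.

Lemma line_one : @line_like C Z.
Proof.
split=> [/constm_scal_evalh[v]|e ee].
  move/(congr1 (fun g : {lrmorphism W Z -> W Z} => g 'X_var)).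
  exact: var_neq_scalar.
pose r := upoly (e 'X_var).
have eE : elt_hom (e 'X_var) = e by apply: hom_var_eq; rewrite elt_homE.
have rr : r \Po r = r.
  rewrite /r -upoly_elt_hom eE; congr (upoly _).
  by rewrite -[LHS]/(@compm C Z Z Z e e 'X_var) ee.
have [r1|r1] := leqP (size r) 1.
  left; apply: (scal_evalh_constm (v := fun=> r`_0)).
  by rewrite -eE scal_evalh_subst /elt_hom (upoly_const (size1_polyC r1)).
(* For r of positive degree, composition with r on the right is injective, and
   it sends r - 'X to 0. *)
right; apply: hom_var_eq; apply: upoly_inj.
rewrite -[RHS]/(upoly 'X_var) upolyX -/r.
apply/eqP; rewrite -subr_eq0 -(comp_poly_eq0 _ r1).
by rewrite comp_polyB comp_polyX rr subrr.
Qed.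

End OneVariable.

Lemma line_card Z : @line_like C Z -> #|` Z| = 1%N.
Proof.
case=> idN idem; apply/eqP; rewrite eqn_leq; apply/andP; split; last first.
  rewrite lt0n; apply/eqP => Z0; apply: idN => Y g h.
  by apply: hom_eq => i; have := ltn_ord i; rewrite {2}Z0.
rewrite leqNgt; apply/negP => Z2.
(* The projection e onto the coordinate line of i0 is a forbidden idempotent. *)
pose i0 := Ordinal (ltnW Z2); pose i1 := Ordinal Z2.
pose e : {lrmorphism W Z -> W Z} :=
  subst (A := W Z) (fun i => if i == i0 then 'X_i0 else 0).
have e0 : e 'X_i0 = 'X_i0 by rewrite [LHS]substX eqxx.
have e1 : e 'X_i1 = 0 by rewrite [LHS]substX.
have ee : @compm C Z Z Z e e = e.
  apply: hom_eq => i; rewrite /e [RHS]substX -[LHS]/(e (e 'X_i)) [e 'X_i]substX.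
  by case: ifP => _; [exact: e0|rewrite linear0].
have [/constm_scal_evalh[v]|] := idem _ ee.
  move/(congr1 (fun g : {lrmorphism W Z -> W Z} => g 'X_i0)).
  by rewrite e0; exact: var_neq_scalar.
move/(congr1 (fun g : {lrmorphism W Z -> W Z} => g 'X_i1)).
rewrite e1 /= -(scale0r (1 : W Z)) => /esym; exact: var_neq_scalar.
Qed.

End Lines.

(** * Bijections of a field that normalise the affine group *)

Section Packing.
Variables (P : fieldType) (A B : comAlgType P) (f : A -> B).
Hypotheses (fL : linear f) (fM : monoid_morphism f).

Definition hom_of : {lrmorphism A -> B} :=
  HB.pack f (GRing.isLinear.Build P A B _ f fL)
    (GRing.isMonoidMorphism.Build A B f fM).

End Packing.

Lemma bijection_field_aut (P : fieldType) (s s' : P -> P) :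
  cancel s s' -> cancel s' s -> {morph s : x y / x + y} -> s 1 = 1 ->
  {morph s : x y / x * y} -> exists sigma : field_aut P, aut sigma =1 s.
Proof.
move=> sK s'K sD s1 sM.
have s0 : s 0 = 0 by apply: (addrI (s 0)); rewrite -sD !addr0.
have sB : zmod_morphism s.
  move=> x y; rewrite sD; congr (_ + _); apply: (addrI (s y)).
  by rewrite -sD !subrr.
pose f : {rmorphism P -> P} :=
  HB.pack s (GRing.isZmodMorphism.Build P P s sB)
    (GRing.isMonoidMorphism.Build P P s (conj s1 sM)).
have fK : cancel f s' by [].
have s'f : cancel s' f by [].
pose g : {rmorphism P -> P} :=
  HB.pack s' (GRing.isZmodMorphism.Build P P s' (can2_zmod_morphism fK s'f))
    (GRing.isMonoidMorphism.Build P P s' (can2_monoid_morphism fK s'f)).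
by exists (@FieldAut P f g sK s'K).
Qed.

(** Normalise [tau] to [s] with [s 0 = 0] and [s 1 = 1]. Conjugating the
    homothety by [a] gives an affine map fixing [0] and sending [1] to [s a],
    so [s] is multiplicative. Conjugating the translation by [b] gives an affine
    map of some slope [k b]; comparing [s (b + c)] with [s (c + b)] shows that
    [k b - 1] is proportional to [s b]. A nonzero factor of proportionality
    would make some slope [k b] vanish, so all slopes are [1] and [s] is
    additive. *)
Lemma semiaffine_field_aut (P : fieldType) (tau tau' : P -> P) :
  cancel tau tau' -> cancel tau' tau ->
  (forall a b, a != 0 ->
    exists a' b', forall c, tau (a * c + b) = a' * tau c + b') ->
  exists (sigma : field_aut P) (a b : P),
    a != 0 /\ forall c, aut sigma c = a * tau c + b.
Proof.
move=> tauK tau'K aff.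
have tauI := can_inj tauK.
pose d := tau 1 - tau 0.
have d0 : d != 0 by rewrite subr_eq0 (inj_eq tauI) oner_eq0.
pose s c := (tau c - tau 0) / d; pose s' c := tau' (c * d + tau 0).
have sK : cancel s s' by move=> c; rewrite /s /s' divfK // subrK tauK.
have s'K : cancel s' s by move=> c; rewrite /s /s' tau'K addrK mulfK.
have sI := can_inj sK.
have s0 : s 0 = 0 by rewrite /s subrr mul0r.
have s1 : s 1 = 1 by rewrite /s divff.
have saff a b : a != 0 ->
    exists a' b', forall c, s (a * c + b) = a' * s c + b'.
  move=> a0; have [a' [b' E]] := aff a b a0.
  exists a', ((a' * tau 0 + b' - tau 0) / d) => c; rewrite /s E.
  by rewrite mulrA -mulrDl; congr (_ / _); rewrite mulrBr !addrA subrK.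
have sM : {morph s : a c / a * c}.
  move=> a c; have [->|a0] := eqVneq a 0; first by rewrite mul0r s0 mul0r.
  have [a' [b' E]] := saff a 0 a0.
  have := E 0; rewrite mulr0 add0r s0 mulr0 add0r => /esym b'0.
  have := E 1; rewrite mulr1 addr0 s1 mulr1 b'0 addr0 => ->.
  by have := E c; rewrite b'0 !addr0.
have sT b : exists k, forall c, s (c + b) = k * s c + s b.
  have [k [b' E]] := saff 1 b (oner_neq0 _); exists k => c.
  have := E 0; rewrite mulr0 add0r s0 mulr0 add0r => ->.
  by rewrite -E mul1r.
have [k sk] := choice sT.
have k0 b : k b != 0.
  apply/eqP => kb; have := sk b 1; rewrite kb mul0r add0r => /sI /eqP.
  by rewrite -subr_eq0 addrK oner_eq0.
have sym b c : (k b - 1) * s c = (k c - 1) * s b.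
  have : s (b + c) = s (c + b) by rewrite addrC.
  rewrite !sk !mulrBl !mul1r => E.
  apply: (addIr (s c + s b)); rewrite addrA subrK -E.
  by rewrite (addrC (s c)) addrA subrK.
have kE b : k b = 1 + (k 1 - 1) * s b.
  by rewrite -sym s1 mulr1 addrC subrK.
have e0 : k 1 - 1 = 0.
  apply/eqP/negPn/negP => e0; have := k0 (s' (- (k 1 - 1)^-1)).
  by rewrite kE s'K mulrN divff // subrr eqxx.
have sD : {morph s : x y / x + y}.
  by move=> x y; rewrite sk kE e0 mul0r addr0 mul1r.
have [sigma sigmaE] := bijection_field_aut sK s'K sD s1 sM.
exists sigma, d^-1, (- tau 0 / d); split; first by rewrite invr_eq0.
by move=> c; rewrite sigmaE /s mulrBl mulrC mulNr.
Qed.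

(** * Every autoequivalence is semi-inner *)

Definition inv_aut (P : fieldType) (sigma : field_aut P) : field_aut P :=
  FieldAut (aut_invK sigma) (autK sigma).

Section CoefficientTwist.
Variables (P : fieldType) (X0 : choiceType).
Local Notation W := (@W P X0).
Implicit Types (X Y Z : {fset X0}) (sigma : field_aut P).

Definition coef_twist sigma X : {rmorphism W X -> W X} := map_mpoly (aut sigma).

Lemma coef_twistP sigma X c p q : coef_twist sigma X (c *: p + q) =
  aut sigma c *: coef_twist sigma X p + coef_twist sigma X q.
Proof. by rewrite /coef_twist /= raddfD /= map_mpolyZ. Qed.

Lemma coef_twistK sigma X :
  cancel (coef_twist sigma X) (coef_twist (inv_aut sigma) X).
Proof. by move=> p; apply/mpolyP => m; rewrite !mcoeff_map_mpoly /= autK. Qed.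

Lemma coef_twistVK sigma X :
  cancel (coef_twist (inv_aut sigma) X) (coef_twist sigma X).
Proof.
by move=> p; apply/mpolyP => m; rewrite !mcoeff_map_mpoly /= aut_invK.
Qed.

Lemma meval_coef_twist sigma X p v :
  (coef_twist sigma X p).@[fun i => aut sigma (v i)] = aut sigma p.@[v].
Proof.
elim/mpolyind: p => [|c m p _ _ IHp].
  by rewrite [coef_twist _ _ _]raddf0 !meval0 rmorph0.
have -> : coef_twist sigma X (c *: 'X_[m] + p) =
    aut sigma c *: 'X_[m] + coef_twist sigma X p.
  by rewrite coef_twistP [coef_twist sigma X 'X_[m]]map_mpolyX.
rewrite !mevalD !mevalZ IHp !mevalX rmorphD rmorphM rmorph_prod.
by congr (_ * _ + _); apply: eq_bigr => i _; rewrite rmorphXn.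
Qed.

End CoefficientTwist.

Section SemiInner.
Variables (P : fieldType) (X0 : choiceType).
Hypothesis P_inf : infinite_set [set: P].
Local Notation W := (@W P X0).
Local Notation C := (Theta0 P X0).
Implicit Types (X Y Z : {fset X0}).

(** Homomorphisms out of [W X] are determined by their value at [t]. Stating
    this for an arbitrary [t] lets an affine change of variable be absorbed
    in the choice of the generator of [W (phi O)]. *)
Definition generator X (t : W X) : Prop :=
  forall (A : comAlgType P) (f g : {lrmorphism W X -> A}), f t = g t -> f = g.

Lemma points_eq X (p q : W X) : (forall v, p.@[v] = q.@[v]) -> p = q.
Proof.
move=> pq; apply: subr0_eq; apply: (mpoly_eval0 P_inf) => v.
by rewrite mevalB pq subrr.
Qed.

Variables (phi psi : functor C C) (phi_psi : is_equiv phi psi) (x0 : X0).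

Definition line0 : {fset X0} := [fset x0]%fset.
Local Notation O := line0.

Lemma card_line0 : #|` O| = 1%N. Proof. exact: cardfs1. Qed.

Lemma card_phi_line0 : #|` phi O| = 1%N.
Proof.
apply: (@line_card P); apply: (equiv_line phi_psi).
exact: (line_one card_line0 P_inf).
Qed.

Local Notation t := ('X_(var card_line0) : W O).
Local Notation u := ('X_(var card_phi_line0) : W (phi O)).

(** Elements of [W X] are morphisms [W O -> W X], so [phi] acts on elements. *)
Definition phi_elt X (w : W X) : W (phi X) :=
  (fmap phi (elt_hom O w : @mor C O X) : {lrmorphism W (phi O) -> W (phi X)}) u.

Lemma phi_elt_hom X (mu : @mor C O X) :
  phi_elt (mu t) = (fmap phi mu : {lrmorphism W (phi O) -> W (phi X)}) u.
Proof.
rewrite /phi_elt; have -> // : elt_hom O (mu t) = mu :> {lrmorphism W O -> W X}.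
by apply: (hom_var_eq (Z1 := card_line0)); rewrite elt_homE.
Qed.

Lemma phi_elt_natural X Y (mu : @mor C X Y) (w : W X) :
  phi_elt (mu w) =
  (fmap phi mu : {lrmorphism W (phi X) -> W (phi Y)}) (phi_elt w).
Proof.
rewrite {2}/phi_elt.
rewrite -[RHS]/((compm (fmap phi mu) (fmap phi (elt_hom O w : @mor C O X))
  : {lrmorphism W (phi O) -> W (phi Y)}) u) -fmapM -phi_elt_hom.
by rewrite /= [subst_fun _ _]elt_homE.
Qed.

Lemma phi_elt_inj X : injective (@phi_elt X).
Proof.
move=> w w' /(hom_var_eq (Z1 := card_phi_line0)) /(equiv_faithful phi_psi).
move/(congr1 (fun f : {lrmorphism W O -> W X} => f t)).
by rewrite !elt_homE.
Qed.

Lemma phi_elt_surj X (q : W (phi X)) : exists w, @phi_elt X w = q.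
Proof.
have [g gE] := equiv_full phi_psi (elt_hom (phi O) q : @mor C (phi O) (phi X)).
by exists (g t); rewrite phi_elt_hom gE elt_homE.
Qed.

(** The action of [phi] on the constants of [W O]. *)
Definition tau c : P := (@phi_elt O c%:A).@[fun=> 0].

Lemma scal_evalh_elt_hom c X : scal_evalh (W X) (fun=> c) = elt_hom O c%:A.
Proof. exact: scal_evalh_subst. Qed.

Lemma phi_elt_const0 c : @phi_elt O c%:A = (tau c)%:A.
Proof.
have : @constm C O O (elt_hom O c%:A).
  by apply: (scal_evalh_constm (v := fun=> c)); rewrite scal_evalh_elt_hom.
rewrite -(equiv_constm phi_psi) => /constm_scal_evalh[v phiv].
by rewrite /tau /phi_elt phiv /= /scal_eval meval_alg.
Qed.

Lemma fmap_const c : (fmap phi (elt_hom O c%:A : @mor C O O)) =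
  scal_evalh (W (phi O)) (fun=> tau c) :> {lrmorphism W (phi O) -> W (phi O)}.
Proof.
apply: (hom_var_eq (Z1 := card_phi_line0)).
by rewrite -[LHS]/(phi_elt c%:A) phi_elt_const0 /= /scal_eval mevalXU.
Qed.

(** Points of [W (phi X)] are constant morphisms to [W (phi O)], hence come from
    points of [W X]; so [phi_elt] acts on values of polynomials by [tau]. *)
Lemma phi_elt_point X (v : 'I_#|` phi X| -> P) :
  exists v0, forall w : W X, (phi_elt w).@[v] = tau w.@[v0].
Proof.
pose ev : @mor C (phi X) (phi O) := scal_evalh (W (phi O)) v.
have [g gE] := equiv_full phi_psi ev.
have /constm_scal_evalh[v0 gv0] : constm g.
  by rewrite -(equiv_constm phi_psi) gE; exact: scal_evalh_constm.
exists v0 => w; apply: (@alg_inj _ (W (phi O))); rewrite /= -phi_elt_const0.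
rewrite -[(w.@[v0])%:A]/(scal_evalh (W O) v0 w) -gv0 phi_elt_natural gE.
by [].
Qed.

Lemma tau_inj : injective tau.
Proof.
move=> c d cd; apply: (@alg_inj _ (W O)); apply: phi_elt_inj.
by rewrite /= !phi_elt_const0 cd.
Qed.

Lemma tau_surj d : exists c, tau c = d.
Proof.
pose ev : @mor C (phi O) (phi O) := scal_evalh (W (phi O)) (fun=> d).
have [g gE] := equiv_full phi_psi ev.
have /constm_scal_evalh[v gv] : constm g.
  by rewrite -(equiv_constm phi_psi) gE; exact: scal_evalh_constm.
exists (v (var card_line0)); apply: (@alg_inj _ (W (phi O))) => /=.
rewrite -phi_elt_const0; have := phi_elt_hom g.
by rewrite gE gv /= /scal_eval !mevalXU.
Qed.

(** An affine map is the action on constants of an automorphism of [W O], which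
    [phi] sends to an automorphism of [W (phi O)]. *)
Lemma tau_affine (a b : P) : a != 0 ->
  exists a' b', forall c, tau (a * c + b) = a' * tau c + b'.
Proof.
move=> a0; pose r : W O := a *: t + b%:A; pose r' : W O := a^-1 *: (t - b%:A).
have rr' : @compm C O O O (elt_hom O r) (elt_hom O r') = @idm C O.
  apply: (hom_var_eq (Z1 := card_line0)).
  rewrite -[LHS]/(elt_hom O r (elt_hom O r' t)) elt_homE linearZ linearB /=.
  rewrite -/(elt_hom O r).
  by rewrite [elt_hom O r t]elt_homE hom_scalar /r addrK scalerA mulVf ?scale1r.
have phirr' := congr1 (fmap phi) rr'; rewrite fmapM fmap1 in phirr'.
have [a' [b' E]] := auto_affine card_phi_line0 phirr'.
exists a', b' => c; rewrite -E.
apply: (@alg_inj _ (W (phi O))) => /=; rewrite -phi_elt_const0.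
pose h : {lrmorphism W O -> W O} := elt_hom O c%:A.
have -> : (a * c + b)%:A = h r.
  by rewrite hom_affine [h t]elt_homE scalerDl scalerA.
by rewrite (phi_elt_natural (h : @mor C O O)) fmap_const.
Qed.

(** With [sigma = a tau + b], the map [th], which sends [w] to
    [a phi_elt (sigma^-1 w) + b], satisfies: the value of [th w] at any point is
    the value of [w] at another point. As points separate polynomials, [th] is
    a homomorphism of algebras. *)
Theorem semi_inner : exists (sigma : field_aut P) (q : W (phi O)),
  [/\ generator t, generator q & forall X,
      exists (theta : {lrmorphism W X -> W (phi X)})
             (theta' : {lrmorphism W (phi X) -> W X}),
      [/\ cancel theta theta', cancel theta' theta &
      forall mu : @mor C O X,
        (fmap phi mu : {lrmorphism W (phi O) -> W (phi X)}) q =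
        theta (coef_twist sigma X (mu t))]].
Proof.
have [tau' tau'K] := choice tau_surj.
have tauK : cancel tau tau' by move=> c; apply: tau_inj; rewrite tau'K.
have [sigma [a [b [a0 sE]]]] := semiaffine_field_aut tauK tau'K tau_affine.
exists sigma, (a *: u + b%:A); split=> [A f g|A f g|X].
- exact: hom_var_eq.
- rewrite !hom_affine => /addIr /(scalerI a0).
  exact: hom_var_eq.
pose s (w : W X) : W (phi X) := a *: phi_elt w + b%:A.
pose s' := inv_aut sigma.
pose th w := s (coef_twist s' X w).
have thP (v : 'I_#|` phi X| -> P) : exists v1, forall w, (th w).@[v] = w.@[v1].
  have [v0 v0E] := phi_elt_point v; exists (fun i => aut sigma (v0 i)) => w.
  rewrite /th /s mevalD mevalZ meval_alg v0E -sE.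
  by rewrite -meval_coef_twist coef_twistVK.
have thL : linear th.
  move=> c p q; apply: points_eq => v; have [v1 E] := thP v.
  by rewrite E mevalD mevalZ -!E -mevalZ -mevalD.
have thM : monoid_morphism th.
  split=> [|p q]; apply: points_eq => v; have [v1 E] := thP v.
    by rewrite E !meval1.
  by rewrite E mevalM -!E -mevalM.
have th_inj : injective th.
  move=> p q /addIr /(scalerI a0) /phi_elt_inj.
  exact: (can_inj (coef_twistVK sigma (X := X))).
have th_surj q : exists p, th p = q.
  have [w wE] := phi_elt_surj (a^-1 *: (q - b%:A)).
  exists (coef_twist sigma X w); rewrite /th /s coef_twistK wE scalerA divff //.
  by rewrite scale1r subrK.
have [th' th'K] := choice th_surj.
pose theta := hom_of thL thM.
have thetaK : cancel theta th' by move=> p; apply: th_inj; rewrite th'K.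
have th'theta : cancel th' theta by [].
exists theta, (hom_of (can2_linear thetaK th'theta)
  (can2_monoid_morphism thetaK th'theta)); split=> // mu.
rewrite -[RHS]/(s (coef_twist s' X (coef_twist sigma X (mu t)))) coef_twistK.
rewrite /s phi_elt_hom.
by rewrite hom_affine.
Qed.

End SemiInner.

(** * Closed congruences are the kernels of morphisms to closed quotients *)

Definition pull (A B : Type) (f : A -> B) (T : set (B * B)) : set (A * A) :=
  [set p | T (f p.1, f p.2)].

Section ClosedKernels.
Variables (P : fieldType) (X0 : choiceType) (H : comAlgType P).
Local Notation W := (@W P X0).
Implicit Types (X Y Z : {fset X0}).

Lemma Hclosed_pull X Y (s : {lrmorphism W X -> W Y}) (T : set (W Y * W Y)) :
  Hclosed H T -> Hclosed H (pull s T).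
Proof.
case=> A ->; exists [set comph mu s | mu in A].
apply/seteqP; split=> [p pT _ [mu Amu <-]|p pT mu Amu]; first exact: pT.
by apply: (pT (comph mu s)); exists mu.
Qed.

Section Point.
Variables (A B : comAlgType P) (T : congruence A) (U : congruence B).
Variables (k : qhom T U) (mu : {lrmorphism B -> H}).
Hypothesis Umu : cong_set U `<=` Ker mu.

Definition qpoint_fun (w : A) : H := mu (repr (k (\pi_(quo T) w))).

Lemma mu_repr b : mu (repr (\pi_(quo U) b)) = mu b.
Proof. exact: (Umu (repr_pi U b)). Qed.

Lemma qpoint_linear : linear qpoint_fun.
Proof.
move=> a x y; rewrite /qpoint_fun piD piZ (qfun_linear k).
rewrite -{1}[k (\pi x)]reprK -{1}[k (\pi y)]reprK -piZ -piD mu_repr.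
by rewrite linearP.
Qed.

Lemma qpoint_monoid : monoid_morphism qpoint_fun.
Proof.
have [k1 kM] := qfun_monoid k; split=> [|x y]; rewrite /qpoint_fun.
  by rewrite pi1 k1 -pi1 mu_repr rmorph1.
rewrite piM kM -{1}[k (\pi x)]reprK -{1}[k (\pi y)]reprK -piM mu_repr.
by rewrite rmorphM.
Qed.

Definition qpoint : {lrmorphism A -> H} := hom_of qpoint_linear qpoint_monoid.

Lemma qpointE w : qpoint w = mu (repr (k (\pi_(quo T) w))).
Proof. by []. Qed.

End Point.

(** If [U] is closed, the homomorphisms [W Y / U -> H] separate the points of
    [W Y / U]; their composites with [k] have the kernel of [k] as common
    kernel. *)
Lemma qhom_kernel_closed X Y (T : congruence (W X)) (U : congruence (W Y))
    (k : qhom T U) : Hclosed H U ->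
  Hclosed H [set p | k (\pi_(quo T) p.1) = k (\pi_(quo T) p.2)].
Proof.
case=> A UA.
have Umu mu : A mu -> cong_set U `<=` Ker mu by rewrite UA => Amu p; apply.
exists [set m |
  exists2 mu, A mu & forall w, m w = mu (repr (k (\pi_(quo T) w)))].
apply/seteqP; split=> [p /= kp m [mu _ mE]|p kp].
  by rewrite /Ker /= !mE kp.
rewrite /= -[LHS]reprK -[RHS]reprK; apply/quoP; rewrite UA => mu Amu.
rewrite /Ker /= -!(qpointE k (Umu _ Amu)); apply: kp.
by exists mu.
Qed.

End ClosedKernels.

Section KernelTransport.
Variables (P : fieldType) (X0 : choiceType).
Hypothesis P_inf : infinite_set [set: P].
Local Notation W := (@W P X0).
Local Notation C := (Theta0 P X0).
Implicit Types (X Y Z : {fset X0}).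

Lemma comp_inclC (H : comAlgType P) Z X (c : CTheta X0 H)
    (k : mor (inclC X0 H P_inf X) c) (f : {lrmorphism W Z -> W X}) p :
  (compm k (fmap (inclC X0 H P_inf) (f : @mor C Z X))
    : qhom (diag_cong (W Z)) (cT c)) (\pi_(quo (diag_cong (W Z))) p) =
  (k : qhom (diag_cong (W X)) (cT c)) (\pi_(quo (diag_cong (W X))) (f p)).
Proof. by rewrite -inclC_homE. Qed.

Lemma inclC_comp_kernel (H : comAlgType P) X (c : CTheta X0 H)
    (k : mor (inclC X0 H P_inf X) c) :
  exists K, Hclosed H K /\ forall Z (f g : {lrmorphism W Z -> W X}),
    compm k (fmap (inclC X0 H P_inf) (f : @mor C Z X)) =
    compm k (fmap (inclC X0 H P_inf) (g : @mor C Z X))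
    <-> forall p, K (f p, g p).
Proof.
pose k' : qhom (diag_cong (W X)) (cT c) := k.
exists [set p | k' (\pi_(quo _) p.1) = k' (\pi_(quo _) p.2)].
split=> [|Z f g]; first exact: qhom_kernel_closed (cTP c).
split=> [fg p|fg]; first by rewrite /= -!comp_inclC fg.
apply: qhom_ext => x; rewrite -[x]reprK.
by rewrite (comp_inclC k f) (comp_inclC k g); exact: fg.
Qed.

(** The pairs [f], [g] that agree modulo [T] are those equalised by the
    projection [k : W X -> W X / T], and [K] is the kernel of [Phi k]. *)
Lemma kernel_transport (H H' : comAlgType P)
    (Phi : functor (CTheta X0 H) (CTheta X0 H')) (phi : functor C C) :
  faithful Phi -> induces_Theta0 P_inf Phi phi ->
  forall X (T : set (W X * W X)), Hclosed H T ->
  exists K, Hclosed H' K /\ forall Z (f g : {lrmorphism W Z -> W X}),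
    (forall p, T (f p, g p)) <->
    (forall p, K
      ((fmap phi (f : @mor C Z X) : {lrmorphism W (phi Z) -> W (phi X)}) p,
       (fmap phi (g : @mor C Z X) : {lrmorphism W (phi Z) -> W (phi X)}) p)).
Proof.
move=> Phi_inj ind X T [A TA]; pose Tc := galA_cong A.
have hT : Hclosed H Tc by exists A.
pose c : CTheta X0 H := CObj hT.
have idT x y : diag (x, y) -> cong_set Tc (idh (W X) x, idh (W X) y).
  by rewrite /diag /= => ->; exact: (cong_refl (congP Tc)).
pose k : mor (inclC X0 H P_inf X) c :=
  @qmap P (W X) (W X) (diag_cong (W X)) Tc (idh (W X)) idT.
have kE x : (k : qhom (diag_cong (W X)) Tc)
    (\pi_(quo (diag_cong (W X))) x) = \pi_(quo Tc) x.
  exact: (@qmapE P _ _ (diag_cong (W X)) Tc (idh (W X)) idT).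
have Tk Z (f g : {lrmorphism W Z -> W X}) : (forall p, T (f p, g p)) <->
    compm (fmap Phi k) (fmap (compf Phi (inclC X0 H P_inf)) (f : @mor C Z X)) =
    compm (fmap Phi k) (fmap (compf Phi (inclC X0 H P_inf)) (g : @mor C Z X)).
  have PhiE (h : @mor C Z X) :
      compm (fmap Phi k) (fmap (compf Phi (inclC X0 H P_inf)) h) =
      fmap Phi (compm k (fmap (inclC X0 H P_inf) h)) by rewrite fmapM.
  rewrite !PhiE TA; split=> [fg|/Phi_inj fg p].
    apply: (congr1 (@fmap _ _ Phi _ _)); apply: qhom_ext => x.
    rewrite -[x]reprK.
    by rewrite (comp_inclC k f) (comp_inclC k g) !kE; apply/quoP/fg.
  apply/(quoP Tc); rewrite -!kE.
  by rewrite -(comp_inclC k f) -(comp_inclC k g) fg.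
(* Generalising over Phi k lets the equality of functors ind be rewritten. *)
move: (fmap Phi k) Tk.
rewrite -[Phi (inclC X0 H P_inf X)]/(compf Phi (inclC X0 H P_inf) X) -ind.
move=> k' Tk; have [K [KH KP]] := inclC_comp_kernel k'.
exists K; split=> // Z f g.
by rewrite Tk; exact: KP.
Qed.

End KernelTransport.

(** * Twisted geometrical equivalence in terms of closed congruences *)

Section TwistedClosed.
Variables (P : fieldType) (X0 : choiceType).
Local Notation W := (@W P X0).
Implicit Types (X Y Z : {fset X0}) (H : comAlgType P) (sigma : field_aut P).

Lemma galA_closed H X (T : set (W X * W X)) : Hclosed H (galA (galT H T)).
Proof. by exists (galT H T). Qed.

Lemma sub_closure H X (T : set (W X * W X)) : T `<=` galA (galT H T).
Proof. by move=> p Tp mu; apply. Qed.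

Lemma closure_min H X (T U : set (W X * W X)) :
  Hclosed H U -> T `<=` U -> galA (galT H T) `<=` U.
Proof.
case=> A -> TU p clp mu Amu; apply: clp => r Tr.
exact: TU Tr _ Amu.
Qed.

Lemma closure_id H X (T : set (W X * W X)) :
  Hclosed H T -> galA (galT H T) = T.
Proof.
by move=> cT; apply/seteqP; split; [exact: closure_min|exact: sub_closure].
Qed.

Lemma geom_equivP H1 H2 : geom_equiv X0 H1 H2 <->
  forall X (T : set (W X * W X)), Hclosed H1 T <-> Hclosed H2 T.
Proof.
split=> [eqv X T|eqv X T].
  by split=> /closure_id <-; [rewrite eqv|rewrite -eqv]; exact: galA_closed.
apply/seteqP; split; apply: closure_min; try exact: sub_closure.
  by apply/eqv; exact: galA_closed.
by apply/eqv; exact: galA_closed.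
Qed.

Definition same_closed sigma H1 H2 : Prop :=
  forall X (T : set (W X * W X)),
    Hclosed H1 (pull (coef_twist sigma X) T) <-> Hclosed H2 T.

Lemma same_closed_sym sigma H1 H2 :
  same_closed sigma H1 H2 -> same_closed (inv_aut sigma) H2 H1.
Proof.
move=> sc X T; rewrite -sc.
have E : pull (coef_twist sigma X) (pull (coef_twist (inv_aut sigma) X) T) = T.
  by apply/seteqP; split=> -[p q]; rewrite /pull /= !coef_twistK.
by rewrite -[X in _ <-> Hclosed _ X]E.
Qed.

Section Untwist.
Variables (sigma : field_aut P) (H : comAlgType P) (X : {fset X0}).

Lemma untwist_linear (mu : {lrmorphism W X -> twist sigma H}) :
  linear (fun w => mu (coef_twist sigma X w) : H).
Proof.
move=> c p q; rewrite coef_twistP linearP.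
by congr (_ + _); rewrite [LHS]/(_ *: _) /= /twist_scale autK.
Qed.

Lemma untwist_monoid (mu : {lrmorphism W X -> twist sigma H}) :
  monoid_morphism (fun w => mu (coef_twist sigma X w) : H).
Proof. by split=> [|p q]; rewrite ?rmorph1 ?rmorphM. Qed.

Lemma twist_linear (mu : {lrmorphism W X -> H}) :
  linear (fun w => mu (coef_twist (inv_aut sigma) X w) : twist sigma H).
Proof.
move=> c p q; rewrite coef_twistP linearP.
by [].
Qed.

Lemma twist_monoid (mu : {lrmorphism W X -> H}) :
  monoid_morphism
    (fun w => mu (coef_twist (inv_aut sigma) X w) : twist sigma H).
Proof. by split=> [|p q]; rewrite ?rmorph1 ?rmorphM. Qed.

(** Composition with the coefficient twist of [W X] is a bijection between the
    homomorphisms from [W X] to the twist of [H] and those to [H]. *)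
Lemma Hclosed_twist (T : set (W X * W X)) :
  Hclosed (twist sigma H : comAlgType P) T <->
  Hclosed H (pull (coef_twist sigma X) T).
Proof.
split=> -[A TA].
  exists [set hom_of (untwist_linear mu) (untwist_monoid mu) | mu in A].
  rewrite TA; apply/seteqP; split=> [p Tp _ [mu Amu <-]|p Tp mu Amu].
    exact: (Tp mu Amu).
  by apply: (Tp (hom_of (untwist_linear mu) (untwist_monoid mu))); exists mu.
exists [set hom_of (twist_linear mu) (twist_monoid mu) | mu in A].
have TE p : T p <-> pull (coef_twist sigma X) T
    (coef_twist (inv_aut sigma) X p.1, coef_twist (inv_aut sigma) X p.2).
  by case: p => p q; rewrite /pull /= !coef_twistVK.
apply/seteqP; split=> [p /TE|p Tp].
  by rewrite TA => Tp _ [mu Amu <-]; exact: (Tp mu Amu).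
apply/TE; rewrite TA => mu Amu.
by apply: (Tp (hom_of (twist_linear mu) (twist_monoid mu))); exists mu.
Qed.

End Untwist.

Lemma twisted_geom_equivP H1 H2 : twisted_geom_equiv X0 H1 H2 <->
  exists sigma, same_closed sigma H1 H2.
Proof.
split=> -[sigma E]; exists sigma.
  by move=> X T; rewrite -Hclosed_twist; move: X T; apply/geom_equivP.
by apply/geom_equivP => X T; rewrite Hclosed_twist; exact: E.
Qed.

Lemma generator_closed H Z X (t : W Z) (T : set (W X * W X))
    (f g : {lrmorphism W Z -> W X}) :
  generator t -> Hclosed H T ->
  T (f t, g t) <-> forall p, T (f p, g p).
Proof.
move=> gen [A ->]; split=> [fg p mu Amu|]; last exact.
have fgmu : comph mu f = comph mu g by apply: gen; exact: fg.
exact: (congr1 (fun h : {lrmorphism W Z -> H} => h p) fgmu).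
Qed.

End TwistedClosed.

(** * Correctness forces twisted geometrical equivalence *)

Section Transport.
Variables (P : fieldType) (X0 : choiceType).
Hypothesis P_inf : infinite_set [set: P].
Local Notation W := (@W P X0).
Local Notation C := (Theta0 P X0).

(** By [semi_inner], a pair of elements of [W X] is related by [pull sigma T]
    exactly when the images under [phi] of the corresponding morphisms
    [W O -> W X] agree modulo the transport of [T] to [W (phi X)]. One direction
    then follows from [kernel_transport] for [Phi1]; the other one from
    [kernel_transport] for [Phi2], after returning from [psi (phi X)] to [X]
    along the natural isomorphism. *)
Lemma induced_same_closed (H1 H2 : comAlgType P)
    (Phi1 : functor (CTheta X0 H1) (CTheta X0 H2))
    (Phi2 : functor (CTheta X0 H2) (CTheta X0 H1)) (phi psi : functor C C) :
  X0 -> faithful Phi1 -> faithful Phi2 ->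
  induces_Theta0 P_inf Phi1 phi -> induces_Theta0 P_inf Phi2 psi ->
  is_equiv phi psi -> exists sigma, same_closed X0 sigma H1 H2.
Proof.
move=> x0 faith1 faith2 ind1 ind2 eqv.
have [sigma [q [gen_t gen_q semi]]] := semi_inner P_inf eqv x0.
exists sigma => X T; have [th [th' [thK th'K thE]]] := semi X.
pose O := line0 x0; pose h (w : W X) : {lrmorphism W O -> W X} := elt_hom O w.
pose t : W O := 'X_(var (card_line0 x0)).
have ht w : h w t = w by exact: elt_homE.
pose ph w : {lrmorphism W (phi O) -> W (phi X)} := fmap phi (h w : @mor C O X).
have phE w : ph w q = th (coef_twist sigma X w).
  by rewrite /ph [LHS]thE [in LHS]ht.
split=> clT.
  have [K [clK KP]] := kernel_transport faith1 ind1 clT.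
  suff -> : T = pull th K by exact: Hclosed_pull.
  have TK p1 p2 : T (p1, p2) <-> K (th p1, th p2).
    rewrite -(coef_twistVK sigma p1) -(coef_twistVK sigma p2).
    move: (coef_twist _ X p1) (coef_twist _ X p2) => w1 w2.
    rewrite -!phE (generator_closed _ _ gen_q clK) -KP.
    by rewrite -(generator_closed _ _ gen_t clT) !ht.
  by apply/seteqP; split=> -[p1 p2] /TK.
have [K [clK KP]] := kernel_transport faith2 ind2 (Hclosed_pull th' clT).
have [[uu [vv [vu uv nat]]] _] := eqv.
pose v : {lrmorphism W X -> W (psi (phi X))} := vv X.
suff -> : pull (coef_twist sigma X) T = pull v K by exact: Hclosed_pull.
have TK w1 w2 :
    T (coef_twist sigma X w1, coef_twist sigma X w2) <-> K (v w1, v w2).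
  rewrite -{1}(thK (coef_twist sigma X w1)) -{1}(thK (coef_twist sigma X w2)).
  rewrite -!phE.
  have := generator_closed (ph w1) (ph w2) gen_q (Hclosed_pull th' clT).
  rewrite {1}/pull /= => ->; rewrite KP.
  pose u0 : {lrmorphism W (psi (phi O)) -> W O} := uu O.
  pose v0 : {lrmorphism W O -> W (psi (phi O))} := vv O.
  have u0K p : u0 (v0 p) = p.
    exact: (congr1 (fun f : {lrmorphism W O -> W O} => f p) (uv O)).
  have psphE w p : (fmap psi (ph w : @mor C (phi O) (phi X)) :
      {lrmorphism W (psi (phi O)) -> W (psi (phi X))}) p = v (h w (u0 p)).
    have natw := nat _ _ (h w : @mor C O X).
    have := congr1 (fun f : @mor C _ _ => compm (vv X) f) natw.
    rewrite compmA vu comp1m => E.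
    exact: (congr1
      (fun f : {lrmorphism W (psi (phi O)) -> W (psi (phi X))} => f p) E).
  rewrite -{2}(ht w1) -{2}(ht w2).
  have -> : K (v (h w1 t), v (h w2 t)) <-> forall p, K (v (h w1 p), v (h w2 p)).
    exact: (generator_closed (comph v (h w1)) (comph v (h w2)) gen_t clK).
  split=> [E p|E p]; last by rewrite !psphE; exact: E.
  by have := E (v0 p); rewrite !psphE u0K.
by apply/seteqP; split=> -[w1 w2] /TK.
Qed.

End Transport.

Section FunctorEquations.
Variables (C D E B : category).

Lemma compfA (K : functor E B) (G : functor D E) (F : functor C D) :
  compf K (compf G F) = compf (compf K G) F.
Proof. by congr Functor; apply: Prop_irrelevance. Qed.

Lemma comp1f (F : functor C D) : compf (idf D) F = F.
Proof.
by case: F => fo fm f1 fM; congr Functor; apply: Prop_irrelevance.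
Qed.

Lemma compf1 (F : functor C D) : compf F (idf C) = F.
Proof.
by case: F => fo fm f1 fM; congr Functor; apply: Prop_irrelevance.
Qed.

Lemma nat_iso_refl (A : category) (F : functor A A) : nat_iso F F.
Proof.
exists (fun a => idm (F a)), (fun a => idm (F a)).
by split=> [a|a|a b f]; rewrite ?comp1m ?compm1.
Qed.

Lemma inverse_equiv (F : functor C D) (G : functor D C) :
  compf G F = idf C -> compf F G = idf D -> is_equiv F G.
Proof. by move=> GF FG; split; rewrite ?GF ?FG; exact: nat_iso_refl. Qed.

End FunctorEquations.

Section Duality.
Variables (P : fieldType) (X0 : choiceType) (H : comAlgType P).
Local Notation W := (@W P X0).
Local Notation kA a := (@Defs.kA P X0 H a).

(** [W X] is projective: lift the images of the variables. *)
Lemma qhom_lift (X Y : {fset X0}) (T : congruence (W X))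
    (U : congruence (W Y)) (k : qhom T U) : Hclosed H U ->
  exists s : {lrmorphism W X -> W Y},
    forall x, k (\pi_(quo T) x) = \pi_(quo U) (s x).
Proof.
case=> A UA.
have Umu mu : A mu -> cong_set U `<=` Ker mu by rewrite UA => Amu p; apply.
pose s : {lrmorphism W X -> W Y} :=
  subst (fun i => repr (k (\pi_(quo T) 'X_i))).
exists s => x; rewrite -[LHS]reprK; apply/quoP; rewrite UA => mu Amu.
have E : qpoint k (Umu _ Amu) = comph mu s.
  by apply: hom_eq => i; rewrite qpointE /= [subst_fun _ _]substX.
exact: (congr1 (fun h : {lrmorphism W X -> H} => h x) E).
Qed.

Lemma cobj_eq (X : {fset X0}) (T U : congruence (W X)) (hT : Hclosed H T)
    (hU : Hclosed H U) : cong_set T = cong_set U -> CObj hT = CObj hU.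
Proof.
move=> /congruence_ext TU; case: U / TU hU => hU.
by rewrite (Prop_irrelevance hT hU).
Qed.

Lemma dual_faithful : faithful (dual X0 H).
Proof.
move=> a b f g fg; apply: khom_ext => nu; apply: val_inj; rewrite /= !khom_repP.
apply: lrmorphism_ext => x.
have : dual_hom f (\pi_(quo (cT (dual_obj b))) x) =
    dual_hom g (\pi_(quo (cT (dual_obj b))) x).
  by rewrite -[dual_hom f]/(fmap (dual X0 H) f) fg.
rewrite (dual_homE (khom_repP f)) (dual_homE (khom_repP g)) => /quoP; apply.
exact: (set_mem (valP nu)).
Qed.

Section KHomOf.
Variables (a b : kobj X0 H) (s : {lrmorphism W (kX b) -> W (kX a)}).
Hypothesis sAB : forall nu, kA a nu -> kA b (comph nu s).

Definition khom_of : khom a b.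
Proof.
exists (fun nu : kA a =>
  exist _ (comph (val nu) s) (mem_set (sAB (set_mem (valP nu))))).
by exists s.
Defined.

Lemma khom_ofE (nu : kA a) : val (khom_of nu) = comph (val nu) s.
Proof. by []. Qed.
End KHomOf.

Lemma dual_full : full (dual X0 H).
Proof.
move=> a b k; have [s sE] := qhom_lift (k : qhom _ _) (cTP (dual_obj a)).
have sAB nu : kA a nu -> kA b (comph nu s).
  move=> Anu; have [T BT] := kAP b; rewrite BT => -[x y] Txy.
  rewrite /Ker /=.
  have : cong_set (cT (dual_obj a)) (s x, s y).
    apply/quoP; rewrite -!sE; congr (qfun k _); apply/quoP.
    by move=> mu; rewrite /= BT; apply.
  by move/(_ nu Anu).
exists (khom_of sAB); apply: qhom_ext => x.
by rewrite -[x]reprK (dual_homE (khom_ofE sAB)) sE.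
Qed.

Lemma dual_surj (c : CTheta X0 H) : exists a, dual X0 H a = c.
Proof.
case: c => X T hT.
have hA : algebraic (galT H T) by exists T.
exists (KObj hA); rewrite /= /dual_obj; apply: cobj_eq.
exact: closure_id.
Qed.

End Duality.

Section Necessity.
Variables (P : fieldType) (X0 : choiceType).
Hypothesis P_inf : infinite_set [set: P].

(** The duality is fully faithful and surjective on objects, so faithfulness
    passes along it. *)
Lemma corresponding_faithful (H1 H2 : comAlgType P)
    (F : functor (KTheta X0 H1) (KTheta X0 H2))
    (Phi : functor (CTheta X0 H1) (CTheta X0 H2)) :
  corresponding F Phi -> faithful F -> faithful Phi.
Proof.
move=> FPhi faithF c d.
have [a <-] := dual_surj c; have [b <-] := dual_surj d => f g fg.
have [f' f'E] := dual_full
  (f : @mor (opc (CTheta X0 H1)) (dual X0 H1 b) (dual X0 H1 a)).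
have [g' g'E] := dual_full
  (g : @mor (opc (CTheta X0 H1)) (dual X0 H1 b) (dual X0 H1 a)).
rewrite -f'E -g'E; apply: (congr1 (@fmap _ _ (dual X0 H1) _ _)).
move: fg; rewrite -f'E -g'E.
have : faithful (compf (dual X0 H2) F).
  by move=> x y u v /dual_faithful /faithF.
by rewrite FPhi; apply.
Qed.

Lemma correct_iso_twisted (H1 H2 : comAlgType P) : X0 ->
  correctly_isomorphic X0 P_inf H1 H2 -> twisted_geom_equiv X0 H1 H2.
Proof.
move=> x0 [F [_ [Phi [_ [Psi PsiPhi PhiPsi]]]]].
move=> [phi ind [psi psiphi phipsi]] _ _.
apply/twisted_geom_equivP.
apply: (@induced_same_closed _ _ P_inf _ _ Phi Psi phi psi) => //.
- by case: (inverse_equiv PsiPhi PhiPsi) => /nat_iso_faithful.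
- by case: (inverse_equiv PsiPhi PhiPsi) => _ /nat_iso_faithful.
- rewrite /induces_Theta0 in ind *.
  rewrite -[RHS]compf1 -phipsi -compfA (compfA _ phi) ind !compfA PsiPhi.
  by rewrite comp1f.
- exact: inverse_equiv.
Qed.

Lemma correct_equiv_twisted (H1 H2 : comAlgType P) : X0 ->
  correctly_equivalent X0 P_inf H1 H2 -> twisted_geom_equiv X0 H1 H2.
Proof.
move=> x0 [F1 [F2 [eqF [Phi1 [Phi2 [c1 c2 [phi [psi [i1 i2 eqv]]]]]] _ _]]].
apply/twisted_geom_equivP.
apply: (induced_same_closed x0 _ _ i1 i2 eqv).
  by apply: corresponding_faithful c1 _; case: eqF => /nat_iso_faithful.
by apply: corresponding_faithful c2 _; case: eqF => _ /nat_iso_faithful.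
Qed.

End Necessity.

(** * Equality of functors *)

(** A morphism packed with its source and target: in this form, morphisms
    between objects that are only provably equal can be compared. *)
Definition arrow (C : category) (a b : C) (f : mor a b) :
    {p : C * C & mor p.1 p.2} :=
  existT (fun p : C * C => mor p.1 p.2) (a, b) f.

Lemma functor_eq (C D : category) (F G : functor C D) :
  (forall (a b : C) (f : mor a b), arrow (fmap F f) = arrow (fmap G f)) ->
  F = G.
Proof.
move=> FG; have FGo : fobj F = fobj G.
  by apply/funext => a; have /(congr1 (fun s => (tag s).1)) := FG _ _ (idm a).
case: F G FGo FG => [F Fm F1 FM] [G Gm G1 GM] /= FGo.
case: G / FGo Gm G1 GM => Gm G1 GM FG.
have FGm : Fm = Gm.
  apply: functional_extensionality_dep => a.
  apply: functional_extensionality_dep => b.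
  apply/funext => f; have := projT2_eq (FG a b f).
  by move: (projT1_eq (FG a b f)) => /= e; rewrite (Prop_irrelevance e erefl).
case: Gm / FGm G1 GM FG => G1 GM _.
by congr Functor; apply: Prop_irrelevance.
Qed.

Lemma arrow_op (C : category) (a b a' b' : C) (f : mor a b) (f' : mor a' b') :
  arrow f = arrow f' ->
  @arrow (opc C) b a f = @arrow (opc C) b' a' f'.
Proof.
move/(congr1 (fun s => existT (fun p : opc C * opc C => @mor (opc C) p.1 p.2)
  ((tag s).2, (tag s).1) (tagged s))).
exact.
Qed.

Section Arrows.
Variables (P : fieldType) (X0 : choiceType) (H : comAlgType P).
Local Notation W := (@W P X0).
Local Notation kA a := (@Defs.kA P X0 H a).
Implicit Types X Y Z : {fset X0}.

Lemma carrow_eq X Y (T T' : congruence (W X)) (U U' : congruence (W Y))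
    (hT : Hclosed H T) (hT' : Hclosed H T') (hU : Hclosed H U)
    (hU' : Hclosed H U') (f : qhom T U) (g : qhom T' U') :
  cong_set T = cong_set T' -> cong_set U = cong_set U' ->
  (forall x, exists2 y, f (\pi_(quo T) x) = \pi_(quo U) y &
                        g (\pi_(quo T') x) = \pi_(quo U') y) ->
  @arrow (CTheta X0 H) (CObj hT) (CObj hU) f =
  @arrow (CTheta X0 H) (CObj hT') (CObj hU') g.
Proof.
move=> /congruence_ext TT' /congruence_ext UU'.
case: T' / TT' hT' g => hT' g; case: U' / UU' hU' g => hU' g fg.
rewrite (Prop_irrelevance hT' hT) (Prop_irrelevance hU' hU).
congr (@arrow (CTheta X0 H) (CObj hT) (CObj hU)).
by apply: qhom_ext => x; rewrite -[x]reprK; have [y -> ->] := fg (repr x).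
Qed.

Lemma karrow_eq X Y (A A' : set {lrmorphism W X -> H})
    (B B' : set {lrmorphism W Y -> H}) (hA : algebraic A) (hA' : algebraic A')
    (hB : algebraic B) (hB' : algebraic B')
    (f : khom (KObj hA) (KObj hB)) (g : khom (KObj hA') (KObj hB')) :
  A = A' -> B = B' ->
  (forall (nu : A) (nu' : A'), val nu = val nu' -> val (f nu) = val (g nu')) ->
  @arrow (KTheta X0 H) (KObj hA) (KObj hB) f =
  @arrow (KTheta X0 H) (KObj hA') (KObj hB') g.
Proof.
move=> AA' BB'; case: A' / AA' hA' g => hA' g; case: B' / BB' hB' g => hB' g fg.
have EA := Prop_irrelevance hA' hA; subst hA'.
have EB := Prop_irrelevance hB' hB; subst hB'.
congr (@arrow (KTheta X0 H) (KObj hA) (KObj hB)).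
by apply: khom_ext => nu; apply: val_inj; exact: fg.
Qed.

Lemma galT_galA X (A : set {lrmorphism W X -> H}) :
  algebraic A -> galT H (galA A) = A.
Proof.
case=> T ->; apply/seteqP; split=> [mu clmu p Tp|mu Tmu p]; last by apply.
by apply: clmu => nu; apply.
Qed.

End Arrows.

(** * Conjugation by a field automorphism *)

Section Conjugation.
Variables (P : fieldType) (X0 : choiceType).
Local Notation W := (@W P X0).
Local Notation C := (Theta0 P X0).
Implicit Types (X Y Z : {fset X0}) (sigma : field_aut P).

Section Conj.
Variables (sigma : field_aut P) (X Y : {fset X0}) (s : {lrmorphism W X -> W Y}).

Definition conj_fun x :=
  coef_twist sigma Y (s (coef_twist (inv_aut sigma) X x)).

Lemma conj_linear : linear conj_fun.
Proof.
by move=> c x y; rewrite /conj_fun coef_twistP linearP coef_twistP /= aut_invK.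
Qed.

Lemma conj_monoid : monoid_morphism conj_fun.
Proof. by split=> [|x y]; rewrite /conj_fun ?rmorph1 ?rmorphM. Qed.

Definition conj_twist : {lrmorphism W X -> W Y} :=
  hom_of conj_linear conj_monoid.

Lemma conj_twistE x :
  conj_twist x = coef_twist sigma Y (s (coef_twist (inv_aut sigma) X x)).
Proof. by []. Qed.

End Conj.

Lemma conj_twist_id sigma X : conj_twist sigma (idh (W X)) = idh (W X).
Proof. by apply: lrmorphism_ext => x; rewrite conj_twistE /= coef_twistVK. Qed.

Lemma conj_twist_comp sigma X Y Z (t : {lrmorphism W Y -> W Z})
    (s : {lrmorphism W X -> W Y}) :
  conj_twist sigma (comph t s) =
  comph (conj_twist sigma t) (conj_twist sigma s).
Proof.
apply: lrmorphism_ext => x.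
rewrite conj_twistE -[RHS]/(conj_twist sigma t (conj_twist sigma s x)).
by rewrite !conj_twistE coef_twistK.
Qed.

(** [inv_aut (inv_aut sigma)] is not convertible to [sigma]; this relation holds
    by computation for [sigma] and [inv_aut sigma] in both orders. *)
Definition mutually_inverse (sigma sigma' : field_aut P) : Prop :=
  aut sigma' = aut_inv sigma /\ aut_inv sigma' = aut sigma.

Lemma inv_autP sigma : mutually_inverse sigma (inv_aut sigma).
Proof. by []. Qed.

Lemma inv_autPV sigma : mutually_inverse (inv_aut sigma) sigma.
Proof. by []. Qed.

Definition push sigma X (T : set (W X * W X)) : set (W X * W X) :=
  pull (coef_twist (inv_aut sigma) X) T.

Section MutuallyInverse.
Variables (sigma sigma' : field_aut P).
Hypothesis inv : mutually_inverse sigma sigma'.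

Lemma coef_twist_inverse X :
  coef_twist sigma' X =1 coef_twist (inv_aut sigma) X /\
  coef_twist (inv_aut sigma') X =1 coef_twist sigma X.
Proof. by case: inv => E E'; split=> x; rewrite /coef_twist ?E //= E'. Qed.

Lemma conj_twist_inverse X Y (s : {lrmorphism W X -> W Y}) :
  conj_twist sigma' (conj_twist sigma s) = s.
Proof.
apply: lrmorphism_ext => x; rewrite !conj_twistE.
by rewrite !(coef_twist_inverse _).1 !(coef_twist_inverse _).2 !coef_twistK.
Qed.

Lemma push_inverse X (T : set (W X * W X)) :
  push sigma' (push sigma T) = T.
Proof.
apply/seteqP; split=> -[p q]; rewrite /push /pull /=;
  by rewrite !(coef_twist_inverse _).2 !coef_twistK.
Qed.

End MutuallyInverse.

Definition conj_functor sigma : functor C C :=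
  @Functor C C id (fun X Y s => conj_twist sigma (s : {lrmorphism W X -> W Y}))
    (conj_twist_id sigma) (fun X Y Z => @conj_twist_comp sigma X Y Z).

Lemma conj_functor_inverse sigma sigma' : mutually_inverse sigma sigma' ->
  compf (conj_functor sigma') (conj_functor sigma) = idf C.
Proof.
move=> inv; apply: functor_eq => X Y s.
by congr (@arrow C X Y); exact: conj_twist_inverse.
Qed.

Lemma pushP sigma X (T : set (W X * W X)) x y :
  push sigma T (coef_twist sigma X x, coef_twist sigma X y) <-> T (x, y).
Proof. by rewrite /push /pull /= !coef_twistK. Qed.

Lemma push_conj_twist sigma X Y (s : {lrmorphism W X -> W Y})
    (T : set (W X * W X)) (U : set (W Y * W Y)) :
  (forall x y, T (x, y) -> U (s x, s y)) ->
  forall x y, push sigma T (x, y) ->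
    push sigma U (conj_twist sigma s x, conj_twist sigma s y).
Proof. by move=> sTU x y /sTU Uxy; rewrite !conj_twistE pushP. Qed.

Lemma push_diag sigma X : push sigma (@diag P (W X)) = @diag P (W X).
Proof.
apply/seteqP; split=> -[x y]; rewrite /push /pull /diag /=; last by move->.
exact: (can_inj (coef_twistVK sigma (X := X))).
Qed.

Lemma push_congruence sigma X (T : congruence (W X)) :
  is_congruence (push sigma T).
Proof.
have [r sy tr cD cM cZ] := congP T.
rewrite /push /pull; split=> [x|x y|x y z|x y x' y'|x y x' y'|a x x'] /=.
- exact: r.
- exact: sy.
- exact: tr.
- by rewrite !rmorphD; exact: cD.
- by rewrite !rmorphM; exact: cM.
have E z : coef_twist (inv_aut sigma) X (a *: z) =
    aut_inv sigma a *: coef_twist (inv_aut sigma) X z.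
  by rewrite -[a *: z]addr0 coef_twistP rmorph0 addr0.
by rewrite !E; exact: cZ.
Qed.

Definition push_cong sigma X (T : congruence (W X)) : congruence (W X) :=
  Congruence (push_congruence sigma T).

Lemma push_closed sigma (H H' : comAlgType P) X (T : set (W X * W X)) :
  same_closed X0 sigma H H' -> Hclosed H T -> Hclosed H' (push sigma T).
Proof.
move=> sc clT; apply/sc.
suff -> : pull (coef_twist sigma X) (push sigma T) = T by [].
by apply/seteqP; split=> -[x y]; [move/pushP|move=> Txy; apply/pushP].
Qed.

End Conjugation.

(** * The functors defined by conjugation *)

Section TwistFunctors.
Variables (P : fieldType) (X0 : choiceType).
Hypothesis P_inf : infinite_set [set: P].
Local Notation W := (@W P X0).
Local Notation kA a := (@Defs.kA P X0 _ a).
Implicit Types (X Y Z : {fset X0}).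

Definition k0hom_of (H : comAlgType P) X Y (s : {lrmorphism W Y -> W X}) :
  k0hom H X Y.
Proof. by exists (fun nu => comph nu s); exists s. Defined.

Section OneDirection.
Variables (sigma : field_aut P) (H H' : comAlgType P).
Hypothesis sc : same_closed X0 sigma H H'.

Definition twistC_obj (c : cobj X0 H) : cobj X0 H' :=
  @CObj _ _ _ (cX c) (push_cong sigma (cT c)) (push_closed sc (cTP c)).

Definition lift_of (c d : cobj X0 H) (k : qhom (cT c) (cT d)) :
    {lrmorphism W (cX c) -> W (cX d)} :=
  projT1 (cid (qhom_lift k (cTP d))).

Lemma lift_ofE (c d : cobj X0 H) (k : qhom (cT c) (cT d)) x :
  k (\pi_(quo (cT c)) x) = \pi_(quo (cT d)) (lift_of k x).
Proof. by rewrite /lift_of; case: cid => s /= ->. Qed.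

Lemma qhom_cong (A B : comAlgType P) (T : congruence A) (U : congruence B)
    (k : qhom T U) (s : A -> B) :
  (forall x, k (\pi_(quo T) x) = \pi_(quo U) (s x)) ->
  forall x y, cong_set T (x, y) -> cong_set U (s x, s y).
Proof. by move=> ks x y /quoP xy; apply/quoP; rewrite -!ks xy. Qed.

Definition twistC_hom (c d : cobj X0 H) (k : qhom (cT c) (cT d)) :
    qhom (cT (twistC_obj c)) (cT (twistC_obj d)) :=
  @qmap P (W (cX c)) (W (cX d)) (cT (twistC_obj c)) (cT (twistC_obj d))
    (conj_twist sigma (lift_of k)) (push_conj_twist (qhom_cong (lift_ofE k))).

(** Two lifts of [k] agree modulo the target congruence, so any lift computes
    the conjugate of [k]. *)
Lemma twistC_homE (c d : cobj X0 H) (k : qhom (cT c) (cT d))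
    (s : {lrmorphism W (cX c) -> W (cX d)}) :
  (forall x, k (\pi_(quo (cT c)) x) = \pi_(quo (cT d)) (s x)) ->
  forall x, twistC_hom k (\pi_(quo (cT (twistC_obj c))) x) =
            \pi_(quo (cT (twistC_obj d))) (conj_twist sigma s x).
Proof.
move=> ks x; rewrite /twistC_hom qmapE; apply/quoP; rewrite !conj_twistE.
by apply/pushP/quoP; rewrite -ks -lift_ofE.
Qed.

Program Definition twistC : functor (CTheta X0 H) (CTheta X0 H') :=
  @Functor (CTheta X0 H) (CTheta X0 H') twistC_obj twistC_hom _ _.
Next Obligation.
move=> c; apply: qhom_ext => x; rewrite -[x]reprK.
by rewrite (@twistC_homE _ _ _ (idh _)) // conj_twist_id.
Qed.
Next Obligation.
move=> c d e g f; apply: qhom_ext => x; rewrite -[x]reprK.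
rewrite (@twistC_homE _ _ _ (comph (lift_of g) (lift_of f))); last first.
  by move=> y; rewrite -[LHS]/(qfun g (qfun f (\pi_(quo (cT c)) y))) !lift_ofE.
rewrite conj_twist_comp -[RHS]/(twistC_hom g
  (twistC_hom f (\pi_(quo (cT (twistC_obj c))) (repr x)))).
by rewrite (twistC_homE (lift_ofE f)) (twistC_homE (lift_ofE g)).
Qed.

(** [H] and [H'] are unrelated as algebras, so an algebraic set is transported
    through its congruence, and not pointwise. *)
Definition twistK_obj (a : kobj X0 H) : kobj X0 H' :=
  @KObj _ _ _ (kX a) (galT H' (push sigma (galA (kA a))))
    (ex_intro _ _ erefl).

Lemma twistK_sub (a b : kobj X0 H) (s : {lrmorphism W (kX b) -> W (kX a)}) :
  (forall x y, galA (kA b) (x, y) -> galA (kA a) (s x, s y)) ->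
  forall nu, kA (twistK_obj a) nu ->
    kA (twistK_obj b) (comph nu (conj_twist sigma s)).
Proof. by move=> sBA nu Anu [x y] /(push_conj_twist sBA) /Anu. Qed.

Definition twistK_hom (a b : kobj X0 H) (f : khom a b) :
    khom (twistK_obj a) (twistK_obj b) :=
  khom_of (twistK_sub (khom_gal (khom_repP f))).

Lemma twistK_homE (a b : kobj X0 H) (f : khom a b)
    (s : {lrmorphism W (kX b) -> W (kX a)}) :
  (forall nu : kA a, val (f nu) = comph (val nu) s) ->
  forall nu : kA (twistK_obj a),
    val (twistK_hom f nu) = comph (val nu) (conj_twist sigma s).
Proof.
move=> fs nu; rewrite khom_ofE; apply: lrmorphism_ext => x.
have Anu : kA (twistK_obj a) (val nu) := set_mem (valP nu).
rewrite -[LHS]/(val nu (conj_twist sigma (khom_rep f) x)).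
rewrite -[RHS]/(val nu (conj_twist sigma s x)) !conj_twistE.
apply: (Anu (_, _)); apply/pushP => mu Amu.
have := khom_repP f (exist _ mu (mem_set Amu)); rewrite fs => E.
exact: (congr1 (fun h : {lrmorphism W (kX b) -> H} => h _) (esym E)).
Qed.

Program Definition twistK : functor (KTheta X0 H) (KTheta X0 H') :=
  @Functor (KTheta X0 H) (KTheta X0 H') twistK_obj twistK_hom _ _.
Next Obligation.
move=> a; apply: khom_ext => nu; apply: val_inj.
rewrite (@twistK_homE _ _ _ (idh _)); last by move=> mu; exact: lrmorphism_ext.
by rewrite conj_twist_id; exact: lrmorphism_ext.
Qed.
Next Obligation.
move=> a b c g f; apply: khom_ext => nu; apply: val_inj.
rewrite (@twistK_homE _ _ _ (comph (khom_rep f) (khom_rep g))); last first.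
  by move=> mu; rewrite /= !khom_repP; exact: lrmorphism_ext.
by rewrite conj_twist_comp; exact: lrmorphism_ext.
Qed.

Lemma galA_setT X : galA [set: {lrmorphism W X -> H}] = @diag P (W X).
Proof.
have [A E] := diag_closed H P_inf X; apply/seteqP; split=> [p Tp|[x y]].
  suff: cong_set (diag_cong (W X)) p by [].
  by rewrite E => mu _; exact: Tp.
by rewrite /diag /= => -> mu.
Qed.

Definition k0_rep X Y (f : k0hom H X Y) : {lrmorphism W Y -> W X} :=
  projT1 (cid (k0P f)).

Lemma k0_repP X Y (f : k0hom H X Y) nu : f nu = comph nu (k0_rep f).
Proof. by rewrite /k0_rep; case: cid. Qed.

(** The points of [W X] with values in [H] separate polynomials. *)
Lemma k0_rep_unique X Y (f : k0hom H X Y) (s : {lrmorphism W Y -> W X}) :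
  (forall nu, f nu = comph nu s) -> k0_rep f = s.
Proof.
move=> fs; apply: lrmorphism_ext => x.
have : galA [set: {lrmorphism W X -> H}] (k0_rep f x, s x).
  move=> nu _; have := fs nu; rewrite k0_repP => E.
  exact: (congr1 (fun h : {lrmorphism W Y -> H} => h x) E).
by rewrite galA_setT.
Qed.

Definition twistK0_hom X Y (f : k0hom H X Y) : k0hom H' X Y :=
  k0hom_of H' (conj_twist sigma (k0_rep f)).

Program Definition twistK0 : functor (K0Theta X0 H) (K0Theta X0 H') :=
  @Functor (K0Theta X0 H) (K0Theta X0 H') id twistK0_hom _ _.
Next Obligation.
move=> X; apply: k0hom_ext => nu; rewrite /= (@k0_rep_unique _ _ _ (idh _)).
  by rewrite conj_twist_id; exact: lrmorphism_ext.
by move=> mu; exact: lrmorphism_ext.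
Qed.
Next Obligation.
move=> X Y Z g f; apply: k0hom_ext => nu.
rewrite /= (@k0_rep_unique _ _ _ (comph (k0_rep f) (k0_rep g))).
  by rewrite conj_twist_comp; exact: lrmorphism_ext.
by move=> mu; rewrite /= !k0_repP; exact: lrmorphism_ext.
Qed.

Lemma twistK_corresponding : corresponding twistK twistC.
Proof.
have E (c : kobj X0 H) :
    galA (galT H' (push sigma (galA (kA c)))) = push sigma (galA (kA c)).
  by apply/closure_id/(push_closed sc); exists (kA c).
apply: functor_eq => a b f; have fP := khom_repP f.
apply: arrow_op; apply: carrow_eq => [||x]; [exact: E|exact: E|].
exists (conj_twist sigma (khom_rep f) x).
  exact: dual_homE (twistK_homE fP) _.
exact: (@twistC_homE (dual_obj b) (dual_obj a) (dual_hom f) (khom_rep f)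
  (dual_homE fP)).
Qed.

Lemma twistC_induces : induces_Theta0 P_inf twistC (conj_functor X0 sigma).
Proof.
apply: functor_eq => X Y s; apply: carrow_eq => [||x];
  try exact/esym/push_diag.
exists (conj_twist sigma s x); first exact: inclC_homE.
exact: (@twistC_homE (inclC_obj H P_inf X) (inclC_obj H P_inf Y) (inclC_hom s) s
  (inclC_homE s)).
Qed.

Lemma twistK_induces : induces_K0 twistK twistK0.
Proof.
have E X : galT H' (push sigma (galA [set: {lrmorphism W X -> H}])) = setT.
  rewrite galA_setT push_diag; apply/seteqP; split=> // mu _ [x y].
  by rewrite /diag /Ker /= => ->.
apply: functor_eq => X Y f; apply: karrow_eq => [||nu nu' nuE]; rewrite ?E //.
have fP mu : val (inclK_hom f mu) = comph (val mu) (k0_rep f).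
  exact: k0_repP.
rewrite -[LHS]/(comph (val nu) (conj_twist sigma (k0_rep f))) nuE.
by rewrite (twistK_homE fP).
Qed.

Lemma twistK_incl : incl_preserving twistK.
Proof.
move=> _ _ [X A B hA hB AB]; constructor=> nu Anu p Bp; apply: Anu => mu Amu.
exact: Bp (AB _ Amu).
Qed.

End OneDirection.

Section TwoDirections.
Variables (sigma sigma' : field_aut P) (H H' : comAlgType P).
Hypothesis inv : mutually_inverse sigma sigma'.
Hypotheses (sc : same_closed X0 sigma H H') (sc' : same_closed X0 sigma' H' H).

Lemma twistC_inverse : compf (twistC sc') (twistC sc) = idf (CTheta X0 H).
Proof.
apply: functor_eq => -[X T hT] [Y U hU] f.
apply: carrow_eq => [||x]; try exact: push_inverse.
have fE := lift_ofE (c := CObj hT) (d := CObj hU) f.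
exists (lift_of (c := CObj hT) (d := CObj hU) f x); last exact: fE.
have := twistC_homE (sc := sc') (twistC_homE (sc := sc) fE) x.
by rewrite (conj_twist_inverse inv).
Qed.

Lemma twistK_inverse :
  compf (twistK sigma' H' H) (twistK sigma H H') = idf (KTheta X0 H).
Proof.
have E X (A : set {lrmorphism W X -> H}) : algebraic A ->
    galT H (push sigma' (galA (galT H' (push sigma (galA A))))) = A.
  move=> algA; rewrite closure_id; last by apply: (push_closed sc); exists A.
  by rewrite push_inverse // galT_galA.
apply: functor_eq => -[X A hA] [Y B hB] f.
apply: karrow_eq => [||nu nu' nuE]; try exact: E.
rewrite -[LHS]/(val (twistK_hom sigma' H (twistK_hom sigma H' f) nu)).
rewrite (twistK_homE (twistK_homE (khom_repP f))) nuE conj_twist_inverse //.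
exact: (esym (@khom_repP _ _ _ (KObj hA) (KObj hB) f nu')).
Qed.

Lemma twistK0_inverse :
  compf (twistK0 sigma' H' H) (twistK0 sigma H H') = idf (K0Theta X0 H).
Proof.
apply: functor_eq => X Y f.
congr (@arrow (K0Theta X0 H) X Y); apply: k0hom_ext => nu.
rewrite [RHS]k0_repP -[k0_rep f in RHS](conj_twist_inverse inv) /=.
by rewrite (@k0_rep_unique _ _ _ _ (conj_twist sigma (k0_rep f))).
Qed.

End TwoDirections.

Section Sufficiency.
Variables (H1 H2 : comAlgType P).
Hypothesis tw : twisted_geom_equiv X0 H1 H2.

Lemma twisted_correct : exists
    (F : functor (KTheta X0 H1) (KTheta X0 H2))
    (G : functor (KTheta X0 H2) (KTheta X0 H1)),
  correct_iso P_inf F /\ correct_equiv P_inf F G.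
Proof.
have [sigma sc] := (twisted_geom_equivP X0 H1 H2).1 tw.
pose sigma' := inv_aut sigma; have sc' := same_closed_sym sc.
exists (twistK sigma H1 H2), (twistK sigma' H2 H1).
have inv := inv_autP sigma; have inv' := inv_autPV sigma.
have KK' := twistK_inverse inv sc; have K'K := twistK_inverse inv' sc'.
have CC' := twistC_inverse inv sc sc'; have C'C := twistC_inverse inv' sc' sc.
have TT' := conj_functor_inverse X0 inv.
have T'T := conj_functor_inverse X0 inv'.
have LL' := twistK0_inverse H1 H2 inv; have L'L := twistK0_inverse H2 H1 inv'.
split; split.
- by exists (twistK sigma' H2 H1).
- exists (twistC sc); split; first exact: twistK_corresponding.
    by exists (twistC sc').
  exists (conj_functor X0 sigma); first exact: twistC_induces.
  by exists (conj_functor X0 sigma').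
- exists (twistK0 sigma H1 H2); first exact: twistK_induces.
  by exists (twistK0 sigma' H2 H1).
- exact: twistK_incl.
- exact: inverse_equiv.
- exists (twistC sc), (twistC sc'); split; try exact: twistK_corresponding.
  exists (conj_functor X0 sigma), (conj_functor X0 sigma').
  by split; [exact: twistC_induces|exact: twistC_induces|exact: inverse_equiv].
- exists (twistK0 sigma H1 H2), (twistK0 sigma' H2 H1).
  by split; [exact: twistK_induces|exact: twistK_induces|exact: inverse_equiv].
- by split; exact: twistK_incl.
Qed.

End Sufficiency.

End TwistFunctors.

(** * Correctness and twisted geometrical equivalence *)

Theorem theorem4 (P : fieldType) (P_inf : infinite_set [set: P])
    (X0 : choiceType) (X0_inf : infinite_set [set: X0])
    (H1 H2 : comAlgType P) :
  (correctly_isomorphic X0 P_inf H1 H2 <->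
   correctly_equivalent X0 P_inf H1 H2) /\
  (correctly_equivalent X0 P_inf H1 H2 <->
   twisted_geom_equiv X0 H1 H2).
Proof.
(* The line P[t] is a polynomial algebra on one element of X0. *)
have [x0 _] := infinite_setN0 X0_inf.
have suff_iso : twisted_geom_equiv X0 H1 H2 ->
    correctly_isomorphic X0 P_inf H1 H2.
  by move/(twisted_correct P_inf) => [F [G [isoF _]]]; exists F.
have suff_equiv : twisted_geom_equiv X0 H1 H2 ->
    correctly_equivalent X0 P_inf H1 H2.
  by move/(twisted_correct P_inf) => [F [G [_ eqFG]]]; exists F, G.
have iso_tw := correct_iso_twisted (P_inf := P_inf) x0.
have equiv_tw := correct_equiv_twisted (P_inf := P_inf) x0.
split; split.
- by move/iso_tw/suff_equiv.
- by move/equiv_tw/suff_iso.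
- exact: equiv_tw.
- exact: suff_equiv.
Qed.
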